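(* Let $d\ge 2$, let $\phi=\tilde p/p$ be a polydegree $(n_1,\dots,n_d)$ rational inner function on $\mathbb{D}^d$ with no singularities on $\overline{\mathbb{D}}^d$, and let $\alpha\in\mathbb{T}$. Then, for every $f\in C(\mathbb{T}^d)$, the Clark measure $\sigma_\alpha$ of $\phi$ satisfies $$\int_{\mathbb{T}^d} f(\zeta)\,d\sigma_\alpha(\zeta)=\sum_{j=1}^{n_d}\int_{\mathbb{T}^{d-1}} f(\zeta',g_j^\alpha(\zeta'))\,\frac{dm(\zeta')}{\left|\frac{\partial\phi}{\partial z_d}(\zeta',g_j^\alpha(\zeta'))\right|},$$ where $g_1^\alpha,\dots,g_{n_d}^\alpha$ are the analytic functions parametrizing the level set $\mathcal{C}_\alpha(\phi)$.
   Context: $\mathbb{D}$ is the open unit disk, $\mathbb{T}$ the unit circle, and $m$ in $dm(\zeta')$ is normalized Lebesgue measure on $\mathbb{T}^{d-1}$. For $\zeta\in\mathbb{T}^d$ write $\zeta'=(\zeta_1,\dots,\zeta_{d-1})$. A rational inner function (RIF) on $\mathbb{D}^d$ is a bounded holomorphic rational function on $\mathbb{D}^d$ whose non-tangential boundary values have modulus $1$ almost everywhere on $\mathbb{T}^d$. Here $\phi=\tilde p/p$ where $p\in\mathbb{C}[z_1,\dots,z_d]$ has no zeros in $\mathbb{D}^d$, has degree $n_j$ in $z_j$, $\tilde p(z)=z_1^{n_1}\cdots z_d^{n_d}\,\overline{p(1/\bar z_1,\dots,1/\bar z_d)}$, and $p,\tilde p$ have no common factor. Then $\phi$ has polydegree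 $(n_1,\dots,n_d)$. Standing assumption: every $n_j>0$. A singularity of $\phi$ is a point where $p=\tilde p=0$; no singularities on $\overline{\mathbb{D}}^d$ means that $p$ has no zeros on $\overline{\mathbb{D}}^d$. For $\alpha\in\mathbb{T}$, $\sigma_\alpha$ is the unique positive Borel measure on $\mathbb{T}^d$ with $\frac{1-|\phi(z)|^2}{|\alpha-\phi(z)|^2}=\int_{\mathbb{T}^d}P_{z}(\zeta)\,d\sigma_\alpha(\zeta)$ for $z\in\mathbb{D}^d$, where $P_z(\zeta)=\prod_{j=1}^d\frac{1-|z_j|^2}{|\zeta_j-z_j|^2}$. $\mathcal{C}_\alpha(\phi)$ is the closure of $\{\zeta\in\mathbb{T}^d:\lim_{r\to1^-}\phi(r\zeta)=\alpha\}$. Under the no-singularity hypothesis, for each $\zeta'\in\mathbb{T}^{d-1}$ there are exactly $n_d$ distinct points $\eta\in\mathbb{T}$ with $\phi(\zeta',\eta)=\alpha$, and $\mathcal{C}_\alpha(\phi)$ is the union of the graphs $\zeta_d=g_j^\alpha(\zeta')$, $j=1,\dots,n_d$, where $g_1^\alpha(\zeta'),\dots,g_{n_d}^\alpha(\zeta')$ are these points. Near each point of $\mathbb{T}^{d-1}$, after a relabelling of the index $j$, the $g_j^\alpha$ are analytic functions; the sum in the formula does not depend on the labelling. *)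

(* Defs.v *)
From HB Require Import structures.
From mathcomp Require Import all_boot all_order all_algebra complex.
From mathcomp Require Import all_classical all_reals all_analysis.
From mathcomp Require mpoly.
(* importing the notations of mpoly would clash with those of the analysis library *)
Import (canonicals, coercions) mpoly.

Set Implicit Arguments.
Unset Strict Implicit.
Unset Printing Implicit Defensive.

Import Order.TTheory GRing.Theory Num.Theory.
Import numFieldNormedType.Exports.

Local Open Scope classical_set_scope.
Local Open Scope ring_scope.

(* The norm topology on R[i], with R[i] as a normed module over itself: the
   library provides these instances for abstract number fields only. *)
HB.instance Definition _ (R : rcfType) := GRing.ComAlgebra.copy R[i] R[i]^o.
HB.instance Definition _ (R : rcfType) := Vector.copy R[i] R[i]^o.
HB.instance Definition _ (R : rcfType) := NormedModule.copy R[i] R[i]^o.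

Notation borel T := (g_sigma_algebraType (@open T)).

Section polydisc.
Context {R : realType}.
Local Notation C := R[i].

Definition polydisc d : set 'rV[C]_d := [set z | forall j, `|z 0 j| < 1].

Definition closed_polydisc d : set 'rV[C]_d := [set z | forall j, `|z 0 j| <= 1].

Definition torus d : set 'rV[C]_d := [set z | forall j, `|z 0 j| = 1].

(* the point (z', w) of C^(d+1) *)
Definition snoc d (z' : 'rV[C]_d) (w : C) : 'rV[C]_d.+1 :=
  \row_i (if unlift ord_max i is Some j then z' 0 j else w).

End polydisc.

Arguments polydisc {R d}.
Arguments closed_polydisc {R d}.
Arguments torus {R d}.

Section torus_measure.
Context {R : realType}.
Local Notation C := R[i].
Local Notation mR := (measurableTypeR R).

Definition tcons n (x : mR * n.-tuple mR) : n.+1.-tuple mR := [tuple of x.1 :: x.2].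

Lemma measurable_tcons n : measurable_fun setT (@tcons n).
Proof. exact: measurable_cons. Qed.

HB.instance Definition _ n :=
  isMeasurableFun.Build _ _ _ _ (@tcons n) (@measurable_tcons n).

(* the n-fold power of Lebesgue measure on [0, 1] *)
Fixpoint cube_measure n : probability (n.-tuple mR) R :=
  match n with
  | 0 => \d_ ([tuple] : 0.-tuple mR)
  | k.+1 => distribution (uniform_prob (@ltr01 R) \x cube_measure k)%E (@tcons k)
  end.

Definition cis (x : R) : C := (cos x +i* sin x)%C.

Definition torus_param n (t : n.-tuple mR) : 'rV[C]_n :=
  \row_j cis (2 * pi * tnth t j).

Lemma continuous_cis : continuous cis.
Proof.
move=> x; apply/cvgrPdist_lt => e e0.
have eE : e = (complex.Re e)%:C%C by rewrite RRe_real// gtr0_real.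
have e0' : 0 < complex.Re e / 2.
  by rewrite divr_gt0// -(ltcR 0 (complex.Re e)) -eE.
near=> y.
rewrite normc_def eE ltcR/=.
have c0 : `|cos x - cos y| < complex.Re e / 2.
  by near: y; have /cvgrPdist_lt := @continuous_cos R x; exact.
have s0 : `|sin x - sin y| < complex.Re e / 2.
  by near: y; have /cvgrPdist_lt := @continuous_sin R x; exact.
rewrite (splitr (complex.Re e)); apply: le_lt_trans (ltrD c0 s0).
rewrite -(ler_pXn2r (ltn0Sn 1)) ?nnegrE ?sqrtr_ge0 ?addr_ge0// sqr_sqrtr; last first.
  by rewrite addr_ge0// sqr_ge0.
by rewrite [leRHS]sqrrD !real_normK ?num_real// [leRHS]addrAC lerDl mulrn_wge0 ?mulr_ge0.
Unshelve. all: by end_near. Qed.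

Lemma measurable_torus_param n :
  measurable_fun setT (@torus_param n : _ -> borel 'rV[C]_n).
Proof.
have openV (U : set 'rV[C]_n) (t : n.-tuple mR) : open U -> U (torus_param t) ->
    exists2 q : n.-tuple (rat * rat),
      (forall j, ratr (tnth q j).1 < tnth t j < ratr (tnth q j).2) &
      forall s : n.-tuple mR,
        (forall j, ratr (tnth q j).1 < tnth s j < ratr (tnth q j).2) ->
        U (torus_param s).
  move=> oU Ut; have /nbhs_ballP[e /= e0 eU] : nbhs (torus_param t) U.
    exact: open_nbhs_nbhs.
  have : \forall d \near (0 : R)^'+, forall j : 'I_n, forall y : R,
      `|tnth t j - y| < d -> `|cis (2 * pi * tnth t j) - cis (2 * pi * y)| < e.
    apply: filter_forall => j.
    have cj : {for (tnth t j : R), continuous (fun y : R => cis (2 * pi * y))}.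
      apply: (@continuous_comp _ _ _ (fun y : R => 2 * pi * y) cis).
        exact: mulrl_continuous.
      exact: continuous_cis.
    have /cvgrPdist_lt /(_ e e0) := cj.
    move=> /nbhs_ballP[d /= d0 dU].
    near=> r => y ty; apply: dU; rewrite /ball/=.
    by apply: (lt_trans ty); near: r; exact: nbhs_right_lt.
  move=> h; near (0 : R)^'+ => d.
  have d0 : 0 < d by near: d; exact: nbhs_right_gt.
  have hd : forall j : 'I_n, forall y : R,
      `|tnth t j - y| < d -> `|cis (2 * pi * tnth t j) - cis (2 * pi * y)| < e.
    by near: d; exact: h.
  have /choice[q qP] : forall j : 'I_n, exists q : rat * rat,
      tnth t j - d < ratr q.1 < tnth t j /\ tnth t j < ratr q.2 < tnth t j + d.
    move=> j.
    have /rat_in_itvoo[q1 q1P] : tnth t j - d < tnth t j by rewrite ltrBlDr ltrDl.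
    have /rat_in_itvoo[q2 q2P] : tnth t j < tnth t j + d by rewrite ltrDl.
    by exists (q1, q2); split; move: q1P q2P; rewrite !in_itv/=.
  exists [tuple q j | j < n] => [j|s sq].
    by rewrite tnth_mktuple; have [/andP[_ ->] /andP[->]] := qP j.
  apply: eU; rewrite /ball/= /mx_ball; split=> // i j; rewrite !mxE.
  rewrite -ball_normE/=; apply: hd.
  have := sq j; rewrite tnth_mktuple; have [/andP[a b] /andP[a' b']] := qP j.
  move=> /andP[c c']; rewrite ltr_distlC; apply/andP; split.
    exact: lt_trans a c.
  exact: lt_trans c' b'.
apply: (@measurability _ _ _ (borel 'rV[C]_n) _ _ (@open 'rV[C]_n)) => // _ [U oU <-].
rewrite setTI.
pose box (q : n.-tuple (rat * rat)) : set (n.-tuple mR) :=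
  [set t | forall j, ratr (tnth q j).1 < tnth t j < ratr (tnth q j).2].
rewrite [X in measurable X](_ : _ =
  \bigcup_(q in [set q | box q `<=` @torus_param n @^-1` U]) box q).
  rewrite bigcup_mkcond; apply: countable_bigcupT_measurable => [|q]; first exact: countableP.
  case: ifPn => // _.
  rewrite (_ : box q = \bigcap_(j in [set: 'I_n])
      ((fun t => tnth t j) @^-1` `](ratr (tnth q j).1), (ratr (tnth q j).2)[)).
    apply: fin_bigcap_measurable => // j _.
    by rewrite -[X in measurable X]setTI; exact: measurable_tnth.
  apply/seteqP; split => t /= h j; first by move=> _; rewrite /= in_itv/=.
  by have := h j I; rewrite /= in_itv.
apply/seteqP; split => [t Ut|t [q qU qt]]; last exact: qU.
by have [q tq qU] := openV _ _ oU Ut; exists q.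
Unshelve. all: by end_near. Qed.

HB.instance Definition _ n :=
  isMeasurableFun.Build _ _ _ _ (@torus_param n : _ -> borel 'rV[C]_n)
    (@measurable_torus_param n).

(* normalized Lebesgue measure on the torus, seen as a Borel measure on C^n:
   the image of Lebesgue measure on [0, 1]^n under t |-> (exp (2 i pi t_j))_j *)
Definition torus_measure n : probability (borel 'rV[C]_n) R :=
  distribution (cube_measure n) (@torus_param n : _ -> borel 'rV[C]_n).

End torus_measure.

Definition Cintegral (R : realType) (disp : measure_display)
    (T : measurableType disp) (mu : {measure set T -> \bar R})
    (D : set T) (f : T -> R[i]) : R[i] :=
  ((\int[mu]_(x in D) complex.Re (f x)) +i*
   (\int[mu]_(x in D) complex.Im (f x)))%C.

Section rational_inner_function.
Context {R : realType} (d : nat).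
Local Notation C := R[i].
Implicit Types (p : mpoly.mpoly d C) (n : mpoly.multinom d) (phi : 'rV[C]_d -> C).

Definition peval p (z : 'rV[C]_d) : C := mpoly.meval (fun j => z 0 j) p.

Definition degree_in p (j : 'I_d) : nat := (\max_(m <- mpoly.msupp p) m j)%N.

(* the polynomial z^n * conj (p (1 / conj z)), given by its coefficients so
   that its values on the coordinate hyperplanes are the right ones *)
Definition reflect n p : mpoly.mpoly d C :=
  \sum_(m <- mpoly.msupp p)
    ((mpoly.mcoeff m p)^*)%C *: mpoly.mpolyX C (mpoly.mnm_sub n m).

Lemma reflectE n p (z : 'rV[C]_d) :
  (forall j, (degree_in p j <= n j)%N) -> (forall j, z 0 j != 0) ->
  peval (reflect n p) z =
  (\prod_j z 0 j ^+ n j) * ((peval p (\row_j ((z 0 j)^*%C)^-1))^*)%C.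
Proof.
move=> pn z0; rewrite /peval /reflect raddf_sum/= (mpoly.mevalE _ p).
rewrite rmorph_sum/= mulr_sumr; apply: eq_big_seq => m mp.
rewrite mpoly.mevalZ mpoly.mevalX rmorphM/= mulrCA; congr (_ * _).
rewrite rmorph_prod -big_split/=; apply: eq_bigr => j _.
have mn : (m j <= n j)%N.
  by apply: leq_trans (pn j); rewrite /degree_in (big_rem m)//= leq_maxl.
rewrite mpoly.mnmBE !mxE rmorphXn/= fmorphV [X in X^-1](conjcK (z 0 j)) exprVn.
by rewrite expfB_cond // (negPf (z0 j)).
Qed.

Definition rational_function n p (z : 'rV[C]_d) : C :=
  peval (reflect n p) z / peval p z.

Definition no_common_factor p q :=
  forall r u v : mpoly.mpoly d C, p = r * u -> q = r * v ->
  exists c : C, r = mpoly.mpolyC d c.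

(* product of Stolz regions with vertices the coordinates of zeta *)
Definition stolz_region (M : R) (zeta : 'rV[C]_d) : set 'rV[C]_d :=
  polydisc `&`
  [set z | forall j, `|z 0 j - zeta 0 j| <= M%:C%C * (1 - `|z 0 j|)].

Definition nontangential_limit phi (zeta : 'rV[C]_d) (l : C) :=
  forall M : R, phi @ within (stolz_region M zeta) (nbhs zeta) --> l.

Definition inner_function phi :=
  [/\ exists B : C, forall z, polydisc z -> `|phi z| <= B,
      forall z, polydisc z -> differentiable phi z &
      {ae torus_measure d, forall zeta, torus zeta ->
         exists2 l, nontangential_limit phi zeta l & `|l| = 1}].

Record polydegree_RIF n p : Prop := {
  RIF_polydegree_gt0 : forall j, (0 < n j)%N ;
  RIF_degree : forall j, degree_in p j = n j ;
  RIF_neq0 : forall z, polydisc z -> peval p z != 0 ;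
  RIF_coprime : no_common_factor p (reflect n p) ;
  RIF_inner : inner_function (rational_function n p) }.

Definition no_singularities p :=
  forall z, closed_polydisc z -> peval p z != 0.

Definition level_set phi (alpha : C) : set 'rV[C]_d :=
  closure [set zeta | torus zeta /\
    (fun r : R => phi (r%:C%C *: zeta)) @ 1^'- --> alpha].

Definition poisson (z zeta : 'rV[C]_d) : R :=
  \prod_j ((1 - Normc.normc (z 0 j) ^+ 2) / Normc.normc (zeta 0 j - z 0 j) ^+ 2).

(* positive Borel measures on the torus are seen as positive Borel measures on
   C^d that vanish off the torus *)
Definition Clark_measure phi (alpha : C)
    (sigma : {measure set (borel 'rV[C]_d) -> \bar R}) :=
  sigma (~` torus) = 0%E /\
  forall z, polydisc z ->
    (((1 - Normc.normc (phi z) ^+ 2) / Normc.normc (alpha - phi z) ^+ 2)%:E =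
     \int[sigma]_(zeta in torus) (poisson z zeta)%:E)%E.

End rational_inner_function.

Section branches.
Context {R : realType} (d : nat).
Local Notation C := R[i].

(* [g j], j < N, are functions on T^d whose graphs parametrize the subset S of
   T^(d+1), with N distinct values at each point. In general monodromy rules
   out continuous branches; measurability makes the integral over each branch
   meaningful. *)
Record parametrizes N (g : 'I_N -> 'rV[C]_d -> C) (S : set 'rV[C]_d.+1) : Prop := {
  param_torus : forall j z', torus z' -> `|g j z'| = 1 ;
  param_inj : forall z', torus z' -> injective (g ^~ z') ;
  param_graphs : S = [set zeta | exists z' j,
    torus z' /\ zeta = snoc z' (g j z')] ;
  param_measurable : forall j,
    measurable_fun (torus : set (borel 'rV[C]_d)) (g j : _ -> borel C) }.

Definition partial_last (phi : 'rV[C]_d.+1 -> C) (z : 'rV[C]_d.+1) : C :=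
  'D_(delta_mx 0 ord_max) phi z.

End branches.

(* Main.v *)
(* For z' on the torus, phi(z', .) is a finite Blaschke product of degree n_d;
   the partial fraction expansion of (alpha + phi) / (alpha - phi) in the last
   variable shows that its one-variable Clark measure is the sum of the point
   masses 1 / |d phi / d z_d| at the points g_j(z'). For w in the disc,
   z' |-> (alpha + phi(z', w)) / (alpha - phi(z', w)) is analytic in each variable
   on the closed polydisc, so integrating against the Poisson kernel of z' shows
   that both sides of the formula have the same integral against every Poisson
   kernel. Averaging over N-th roots of unity gives linear combinations of Poisson
   kernels that approximate any continuous function uniformly on the torus, and
   both sides are bounded for the uniform norm. *)

Require Import Defs.
From HB Require Import structures.
From mathcomp Require Import all_boot all_order all_algebra complex.
From mathcomp Require Import all_classical all_reals all_analysis.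
From mathcomp Require Import measurable_realfun.
From mathcomp Require mpoly.
From mathcomp Require Import ring lra.
Import (canonicals, coercions) mpoly.

Set Implicit Arguments.
Unset Strict Implicit.
Unset Printing Implicit Defensive.

Import Order.TTheory GRing.Theory Num.Theory.
Import numFieldNormedType.Exports.

Local Open Scope classical_set_scope.
Local Open Scope ring_scope.

(** * The one-variable Poisson kernel *)

(** Analyticity is handled through polynomials: along each variable the functions met here are
    quotients whose denominator has no zero on the closed disc, hence uniform limits of polynomials
    there, and for polynomials the averages over the circle are explicit. Two obstacles shape the
    rest. The quotient [(alpha + phi) / (alpha - phi)] must have no pole when z' runs over the whole
    closed polydisc, not only the torus. On the torus the Blaschke structure of the slices gives
    |phi| < 1; compactness makes this uniform in z', and a maximum principle carries it inside.
    Moreover the branches are only measurable, so a single term of the sum over j need not be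
    continuous in z'. The weight is therefore treated as a continuous function on T^(d+1), composed
    with measurable graphs, and only the sum over j is compared with a harmonic function. A slice of
    p may have degree below n_d; the missing roots become Blaschke zeros at the origin, so that
    every slice has exactly n_d factors. The derivative on the circle is then, in modulus, a sum of
    Poisson kernels, hence positive. *)

Section unit_disc.
Context {R : realType}.
Local Notation C := R[i].
Implicit Types (w z : C).

Lemma normC_normc w : `|w| = (Normc.normc w)%:C%C.
Proof. by []. Qed.

Lemma normc_lt1 w : (Normc.normc w < 1) = (`|w| < 1).
Proof. by rewrite normC_normc -(ltcR _ 1). Qed.

Lemma normc_eq1 w : `|w| = 1 -> Normc.normc w = 1.
Proof. by rewrite normC_normc => /(@complexI R). Qed.

Lemma normc_ge0 w : 0 <= Normc.normc w.
Proof. by rewrite -ler0c -normC_normc. Qed.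

Lemma normc_gt0 w : (0 < Normc.normc w) = (w != 0).
Proof. by rewrite -(ltcR 0) -normC_normc normr_gt0. Qed.

Lemma normc_sqr w : (Normc.normc w ^+ 2)%:C%C = w * w^*%C.
Proof. by rewrite rmorphXn/= -normC_normc sqr_normc. Qed.

Lemma conjc_unit w : `|w| = 1 -> w^*%C = w^-1.
Proof. by move=> w1; rewrite invc_norm w1 expr1n invr1 mul1r. Qed.

Lemma unit_neq0 w : `|w| = 1 -> w != 0.
Proof. by move=> w1; rewrite -normr_gt0 w1. Qed.

Lemma one_subM_neq0 z w : `|z| < 1 -> `|w| <= 1 -> 1 - z * w != 0.
Proof.
move=> z1 w1; apply/eqP => /subr0_eq zw.
have : `|z * w| < 1 by rewrite normrM (le_lt_trans _ z1)// ler_piMr.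
by rewrite -zw normr1 ltxx.
Qed.

Definition pker w z : R := (1 - Normc.normc w ^+ 2) / Normc.normc (z - w) ^+ 2.

Lemma pker_ge0 w z : `|w| < 1 -> 0 <= pker w z.
Proof.
rewrite -normc_lt1 => w1; rewrite divr_ge0 ?sqr_ge0// subr_ge0.
by rewrite expr_le1// ?normc_ge0// ltW.
Qed.

Lemma pkerE w z : `|z| = 1 ->
  (pker w z)%:C%C = (1 - w * w^*%C) * z / ((z - w) * (1 - w^*%C * z)).
Proof.
move=> z1; rewrite /pker rmorphM fmorphV rmorphB/= !normc_sqr.
rewrite rmorphB /= (conjc_unit z1) rmorph1 -!mulrA; congr (_ * _).
have z0 := unit_neq0 z1.
by rewrite (_ : z^-1 - _ = (1 - w^*%C * z) / z) ?invfM ?invrK; [ring|field].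
Qed.

Lemma pker_neq0 w z : `|w| < 1 -> `|z| = 1 -> z - w != 0 /\ 1 - w^*%C * z != 0.
Proof.
move=> w1 z1; split; last by apply: one_subM_neq0; rewrite ?normcJ ?z1.
by rewrite subr_eq0; apply: contraTneq w1 => <-; rewrite z1 ltxx.
Qed.

(** On the circle, the kernel is the real part of a function of [z] that is analytic on the closed
    disc. Its measurability, its bound and its averages over roots of unity are read off this
    form. *)
Lemma pker_Re w z : `|w| < 1 -> `|z| = 1 ->
  pker w z = 2 * complex.Re (1 - w^*%C * z)^-1 - 1.
Proof.
move=> w1 z1; apply: (@complexI R).
have z0 := unit_neq0 z1; have [d1 d2] := pker_neq0 w1 z1.
rewrite pkerE// rmorphB rmorphM/= rmorph1 rmorph_nat ReJ_add.
have -> : ((1 - w^*%C * z)^-1)^*%C = ((z - w) / z)^-1.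
  rewrite conjc_inv rmorphB rmorphM/= [X in X * _](conjcK w) (conjc_unit z1).
  by congr _^-1; rewrite [X in X - _]conjc1; field.
by field; rewrite d1 d2 z0.
Qed.

(** The factor [z - w] cancels the pole inside the disc, and what remains is analytic on the closed
    disc. *)
Lemma mulB_pker w z : `|w| < 1 -> `|z| = 1 ->
  (z - w) * (pker w z)%:C%C = (1 - w * w^*%C) * (z / (1 - w^*%C * z)).
Proof.
move=> w1 z1; have [d1 d2] := pker_neq0 w1 z1.
by rewrite pkerE//; field; rewrite d1 d2.
Qed.

End unit_disc.

(** * Uniform limits of polynomials on the closed disc *)

Section disc_algebra.
Context {R : realType}.
Local Notation C := R[i].
Implicit Types (F G : C -> C) (q a b : {poly C}).

(** Approximation is taken as the definition because the mean value and Poisson formulas are proved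
    for polynomials and then pass to uniform limits. *)
Definition disc_algebra F := forall e : R, 0 < e ->
  exists q, forall w : C, `|w| <= 1 -> `|F w - q.[w]| <= e%:C%C.

Lemma disc_algebra_ext F G : (forall w : C, `|w| <= 1 -> F w = G w) ->
  disc_algebra F -> disc_algebra G.
Proof.
move=> FG dF e /dF[q qF]; exists q => w w1.
by rewrite -FG// qF.
Qed.

Lemma disc_algebra_horner q : disc_algebra (horner q).
Proof. by move=> e e0; exists q => w _; rewrite subrr normr0 ler0c ltW. Qed.

Lemma horner_bounded_disc q :
  exists2 M : R, 0 < M & forall w : C, `|w| <= 1 -> `|q.[w]| <= M%:C%C.
Proof.
exists (1 + \sum_(i < size q) Normc.normc q`_i).
  by rewrite ltr_pwDl// sumr_ge0// => i _; exact: normc_ge0.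
move=> w w1; rewrite horner_coef; apply: (le_trans (ler_norm_sum _ _ _)).
rewrite rmorphD raddf_sum ler_wpDl ?rmorph1 ?ler01//; apply: ler_sum => i _.
by rewrite -[leRHS]/(`|q`_i|) normrM ler_piMr// normrX exprn_ile1.
Qed.

Lemma disc_algebra_bounded F : disc_algebra F ->
  exists2 M : R, 0 < M & forall w : C, `|w| <= 1 -> `|F w| <= M%:C%C.
Proof.
move=> /(_ 1 ltr01)[q qF]; have [M M0 MP] := horner_bounded_disc q.
exists (1 + M); first by rewrite addr_gt0.
move=> w w1; rewrite -(subrK q.[w] (F w)) (le_trans (ler_normD _ _))//.
by rewrite rmorphD lerD ?qF ?MP.
Qed.

Lemma disc_algebraM F G : disc_algebra F -> disc_algebra G ->
  disc_algebra (fun w => F w * G w).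
Proof.
move=> dF dG e e0; have [M M0 FM] := disc_algebra_bounded dF.
have [q qG] := dG (e / 2 / M) (divr_gt0 (divr_gt0 e0 (ltr0Sn _ 1)) M0).
have [M' M'0 qM'] := horner_bounded_disc q.
(* The tolerance for [F] depends on a bound for [q], so [G] has to be approximated before [F]. *)
have [r rF] := dF (e / 2 / M') (divr_gt0 (divr_gt0 e0 (ltr0Sn _ 1)) M'0).
exists (r * q) => w w1.
have -> : F w * G w - (r * q).[w] = F w * (G w - q.[w]) + (F w - r.[w]) * q.[w].
  by rewrite hornerM; ring.
rewrite (le_trans (ler_normD _ _))// !normrM.
have -> : e%:C%C = M%:C%C * (e / 2 / M)%:C%C + (e / 2 / M')%:C%C * M'%:C%C.
  rewrite -!rmorphM -rmorphD; congr (_%:C%C); field.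
  by rewrite !gt_eqF.
by apply: lerD; apply: ler_pM; rewrite ?normr_ge0 ?FM ?qG ?rF ?qM'.
Qed.

Lemma expr_lt_eps (x e : R) : 0 <= x < 1 -> 0 < e -> exists n, x ^+ n < e.
Proof.
move=> /andP[x0 x1] e0.
have : x ^+ n @[n --> \oo] --> 0 by apply: cvg_expr; rewrite ger0_norm.
move=> /cvgrPdist_lt /(_ e e0)[n _ /(_ n (leqnn n))] /=.
by rewrite sub0r normrN ger0_norm ?exprn_ge0// => ?; exists n.
Qed.

(** Partial sums of the geometric series: the remainder [(z w)^n / (1 - z w)] is at most
    [x^n / (1 - x)] with [x = |z|], whence the tolerance [e * (1 - x)] for [x^n]. *)
Lemma disc_algebra_geometric (z : C) : `|z| < 1 ->
  disc_algebra (fun w => (1 - z * w)^-1).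
Proof.
move=> z1 e e0; pose x := Normc.normc z.
have x1 : x < 1 by rewrite normc_lt1.
have x01 : 0 <= x < 1 by rewrite normc_ge0 normc_lt1.
have e0' : 0 < e * (1 - x) by rewrite mulr_gt0// subr_gt0.
have [n xn] := expr_lt_eps x01 e0'.
exists (\sum_(i < n) (z *: 'X) ^+ i) => w w1.
have zw := one_subM_neq0 z1 w1.
rewrite horner_sum; under eq_bigr do rewrite horner_exp hornerZ hornerX.
have := subrX1 (z * w) n; set s := \sum_(i < n) _ => h.
have -> : (1 - z * w)^-1 - s = (z * w) ^+ n / (1 - z * w).
  have -> : (z * w) ^+ n = 1 + (z * w - 1) * s by rewrite -h; ring.
  by field.
rewrite normrM normfV ler_pdivrMr ?normr_gt0//.
have h' : (1 - x)%:C%C <= `|1 - z * w|.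
  rewrite (le_trans _ (lerB_dist _ _))// normr1 rmorphB lerB//.
  by rewrite normrM ler_piMr.
apply: le_trans (ler_wpM2l _ h'); last by rewrite ler0c ltW.
rewrite -rmorphM; apply: le_trans (_ : (x ^+ n)%:C%C <= _); last first.
  by rewrite lecR ltW.
rewrite rmorphXn normrX lerXn2r ?nnegrE ?normr_ge0 ?ler0c ?normc_ge0//.
by rewrite -[leRHS]/(`|z|) normrM ler_piMr.
Qed.

(** The roots [r] of [q] lie outside the closed disc, so each factor [1 / (w - r)] is a constant
    times the sum of a geometric series in [w / r]. *)
Lemma disc_algebra_inv q : (forall w : C, `|w| <= 1 -> q.[w] != 0) ->
  disc_algebra (fun w => q.[w]^-1).
Proof.
move=> q0; have [rs qE] := closed_field_poly_normal q.
have l0 : lead_coef q != 0.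
  by rewrite lead_coef_eq0; apply: contraNneq (q0 0 _) => [->|]; rewrite ?horner0 ?normr0.
have : all (fun r : C => 1 < `|r|) rs.
  apply/allP => r rrs; rewrite real_ltNge ?num_real ?normr_real ?real1//.
  apply/negP => /q0; rewrite qE hornerZ horner_prod (big_rem r)//=.
  by rewrite hornerXsubC subrr mul0r mulr0 eqxx.
move=> rs1; apply: (@disc_algebra_ext
  (fun w => (lead_coef q)^-1%:P.[w] * (\prod_(r <- rs) ('X - r%:P)).[w]^-1)).
  by move=> w _; rewrite [in RHS]qE hornerZ invfM hornerC.
apply: disc_algebraM; first exact: disc_algebra_horner.
elim: rs rs1 {qE} => [_|r rs ih /= /andP[r1 /ih rs1]].
  apply: disc_algebra_ext (disc_algebra_horner 1) => w _.
  by rewrite big_nil hornerC invr1.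
have r0 : r != 0 by rewrite -normr_gt0 (lt_trans _ r1).
have dr : disc_algebra (fun w => (- r)^-1%:P.[w] * (1 - r^-1 * w)^-1).
  apply: disc_algebraM; first exact: disc_algebra_horner.
  by apply: disc_algebra_geometric; rewrite normfV invf_lt1 // (lt_trans _ r1).
apply: disc_algebra_ext (disc_algebraM dr rs1) => w w1.
rewrite big_cons hornerM hornerXsubC invfM hornerC; congr (_ * _).
have r1' : `|r^-1| < 1 by rewrite normfV invf_lt1 // (lt_trans _ r1).
have := one_subM_neq0 r1' w1 => h.
rewrite -invfM; congr _^-1; by field.
Qed.

Lemma disc_algebra_frac a b : (forall w : C, `|w| <= 1 -> b.[w] != 0) ->
  disc_algebra (fun w => a.[w] / b.[w]).
Proof.
move=> b0; apply: disc_algebraM; first exact: disc_algebra_horner.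
exact: disc_algebra_inv.
Qed.

End disc_algebra.

(** * Integrals of bounded real functions *)

Section Rintegral_tools.
Context {R : realType} {disp : measure_display} {T : measurableType disp}.
Variables (mu : {measure set T -> \bar R}) (D : set T).
Hypotheses (mD : measurable D) (muD : (mu D < +oo)%E).
Implicit Types f g : T -> R.

Lemma bounded_integrable f (M : R) : measurable_fun D f ->
  (forall x, D x -> `|f x| <= M) -> mu.-integrable D (EFin \o f).
Proof.
move=> mf fM; apply: measurable_bounded_integrable => //.
by exists M; split; [exact: num_real|move=> y My x Dx]; exact: le_trans (fM _ Dx) (ltW My).
Qed.

Lemma Rintegral_sum I (s : seq I) (h : I -> T -> R) :
  (forall i, mu.-integrable D (EFin \o h i)) ->
  \int[mu]_(x in D) (\sum_(i <- s) h i x) = \sum_(i <- s) \int[mu]_(x in D) h i x.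
Proof.
move=> ih; elim: s => [|i s IH].
  under eq_Rintegral do rewrite big_nil.
  by rewrite big_nil Rintegral_cst// mul0r.
rewrite big_cons -IH -RintegralD//.
  by apply: eq_Rintegral => x _; rewrite big_cons.
have := @integrable_sum _ _ _ mu D mD _ s xpredT (fun i => EFin \o h i) (fun i _ => ih i).
by congr (_.-integrable _ _); apply/funext => x /=; rewrite sumEFin.
Qed.

Lemma Rintegral_le_dist f g (e : R) :
  mu.-integrable D (EFin \o f) -> mu.-integrable D (EFin \o g) ->
  (forall x, D x -> `|f x - g x| <= e) ->
  `|\int[mu]_(x in D) f x - \int[mu]_(x in D) g x| <= e * fine (mu D).
Proof.
move=> fi gi fg; rewrite -RintegralB//.
have fgi : mu.-integrable D (EFin \o (f \- g)).
  have := integrableB mD fi gi.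
  by congr (_.-integrable _ _); apply/funext => x /=; rewrite EFinB.
rewrite (le_trans (le_normr_Rintegral _ fgi))// -Rintegral_cst//.
apply: le_Rintegral => //; first exact: integrable_norm.
apply: (@bounded_integrable _ `|e|) => //.
Qed.

End Rintegral_tools.

(** * Poisson integrals on the circle and the torus *)

Section circle_integral.
Context {R : realType}.
Local Notation C := R[i].
Local Notation mR := (measurableTypeR R).
Local Notation U := (uniform_prob (@ltr01 R)).
Local Notation circ x := (cis (2 * pi * x : R)).

Lemma Rintegral_uniform01 (f : R -> R) : measurable_fun setT f ->
  \int[U]_x f x = \int[lebesgue_measure]_(x in `[0, 1]) f x.
Proof.
move=> mf; rewrite /Rintegral [in LHS]integralE [in RHS]integralE.
have mf' : measurable_fun [set: mR] (fun x => (f x)%:E) by exact/measurable_EFinP.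
rewrite !integral_uniform.
- by rewrite subr0 invr1 !mul1e.
- exact: measurable_funeneg.
- by move=> x; exact: funeneg_ge0.
- exact: measurable_funepos.
- by move=> x; exact: funepos_ge0.
Qed.

Lemma Rintegral_uniform01_deriv (F f : R -> R) : continuous f ->
  (forall x : R, is_derive x (1 : R) F (f x)) -> \int[U]_x f x = F 1 - F 0.
Proof.
move=> cf dF; rewrite Rintegral_uniform01; last exact: continuous_measurable_fun.
have cF : continuous F.
  by move=> x; apply/differentiable_continuous/derivable1_diffP; case: (dF x).
rewrite /Rintegral (@continuous_FTC2 _ f F 0 1)//.
- exact: continuous_subspaceT.
- split.
  + by move=> x _; case: (dF x).
  + by apply: cvg_at_right_filter; exact: cF.
  + by apply: cvg_at_left_filter; exact: cF.
- by move=> x _; apply: etrans (derive1E _ _) _; case: (dF x).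
Qed.

Lemma cisD (x y : R) : cis (x + y) = cis x * cis y.
Proof.
by rewrite /cis cosD sinD; congr Complex; ring.
Qed.

Lemma cisX (x : R) n : cis x ^+ n = cis (n%:R * x).
Proof.
elim: n => [|n ih]; first by rewrite expr0 mul0r /cis cos0 sin0.
by rewrite exprS ih -cisD mulrS mulrDl mul1r.
Qed.

Lemma normc_cis (x : R) : `|cis x| = 1.
Proof. by rewrite normc_def/= cos2Dsin2 sqrtr1. Qed.

Lemma circ_natM k : cis (2 * pi * k%:R) = 1 :> C.
Proof.
rewrite mulrC -cisX /cis [2 * pi]mulr_natl cos2pi sin2pi.
by rewrite -[(1 +i* 0)%C]/(1 : C) expr1n.
Qed.

Lemma ReM_cis (c : C) (x : R) :
  complex.Re (c * cis x) = complex.Re c * cos x - complex.Im c * sin x.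
Proof. by case: c. Qed.

Lemma continuous_ReM_cis (c : C) (a : R) :
  continuous (fun x : R => complex.Re (c * cis (a * x)) : R).
Proof.
rewrite (_ : (fun x : R => _) =
    (fun x => complex.Re c * cos (a * x) - complex.Im c * sin (a * x))); last first.
  by apply/funext => x; rewrite ReM_cis.
have ca : continuous (fun y : R => a * y) by exact: mulrl_continuous.
move=> x; apply: cvgB; apply: cvgM; [exact: cvg_cst| |exact: cvg_cst|].
  by apply: continuous_comp; [exact: ca|exact: continuous_cos].
by apply: continuous_comp; [exact: ca|exact: continuous_sin].
Qed.

Lemma Rintegral_ReM_cis (c : C) (k : nat) : (0 < k)%N ->
  \int[U]_x complex.Re (c * circ (x * k%:R)) = 0.
Proof.
move=> k0; pose a : R := k%:R * (2 * pi).
have a0 : a != 0.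
  by rewrite !mulf_neq0 ?pnatr_eq0 ?lt0n_neq0//; exact: lt0r_neq0 (pi_gt0 R).
have cE x : complex.Re (c * circ (x * k%:R)) = complex.Re (c * cis (a * x)) :> R.
  by congr (complex.Re (_ * cis _)); rewrite /a; ring.
under eq_Rintegral do rewrite cE.
(* A primitive of [Re (c exp (i a x))]; it takes the same value at 0 and at 1 because [a] is a
   multiple of [2 pi]. *)
pose F (x : R) := a^-1 * (complex.Re c * sin (a * x) + complex.Im c * cos (a * x)).
transitivity (F 1 - F 0); first apply: Rintegral_uniform01_deriv.
- exact: continuous_ReM_cis.
- move=> x; rewrite /F.
  have dm : is_derive x (1 : R) (fun x : R => a * x) a.
    by apply: trigger_derive; rewrite /GRing.scale/= mulr1.
  have ds := is_derive1_comp (is_derive_sin (a * x)) dm.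
  have dc := is_derive1_comp (is_derive_cos (a * x)) dm.
  apply: trigger_derive; rewrite ReM_cis /GRing.scale/=.
  by field.
- rewrite /F mulr1 mulr0 -/(cis 0) /a sin0 cos0.
  have [] := circ_natM k; rewrite [2 * pi * k%:R]mulrC => -> ->.
  by rewrite subrr.
Qed.

Lemma circX (x : R) n : circ x ^+ n = circ (x * n%:R) :> C.
Proof. by rewrite cisX; congr cis; ring. Qed.

Lemma Re_sum I (s : seq I) (F : I -> C) :
  complex.Re (\sum_(i <- s) F i) = \sum_(i <- s) complex.Re (F i).
Proof. by elim/big_rec2: _ => //= i y z _ <-; case: (F i) z => ? ? []. Qed.

Lemma Re_horner_circ (q : {poly C}) (x : R) :
  complex.Re q.[circ x] = \sum_(i < size q) complex.Re (q`_i * circ (x * i%:R)).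
Proof. by rewrite horner_coef Re_sum; apply: eq_bigr => i _; rewrite circX. Qed.

Lemma measurable_Re_horner_circ (q : {poly C}) :
  measurable_fun [set: mR] (fun x => complex.Re q.[circ x] : R).
Proof.
rewrite (_ : (fun x : mR => _) =
    (fun x => \sum_(i < size q) complex.Re (q`_i * cis ((2 * pi * i%:R) * x)))).
  by apply: measurable_sum => i; apply: continuous_measurable_fun; exact: continuous_ReM_cis.
apply/funext => x; rewrite Re_horner_circ; apply: eq_bigr => i _.
by congr (complex.Re (_ * cis _)); ring.
Qed.

Lemma normr_Re (z : C) : `|complex.Re z| <= Normc.normc z.
Proof. by rewrite -lecR; exact: normc_ge_Re. Qed.

Lemma measurable_Re_disc_algebra (F : C -> C) : disc_algebra F ->
  measurable_fun [set: mR] (fun x => complex.Re (F (circ x)) : R).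
Proof.
move=> dF; have /choice[q qF] : forall n : nat, exists q : {poly C},
    forall w : C, `|w| <= 1 -> `|F w - q.[w]| <= (n.+1%:R^-1)%:C%C.
  by move=> n; apply: dF; rewrite invr_gt0 ltr0Sn.
apply: (@measurable_fun_cvg _ _ _ _ (fun n x => complex.Re (q n).[circ x])).
  by move=> n; exact: measurable_Re_horner_circ.
move=> x _; apply/cvgrPdist_le => e e0.
near=> n.
have := qF n (circ x); rewrite normc_cis lexx => /(_ isT).
rewrite lecR => qn.
rewrite -raddfB (le_trans (normr_Re _))// (le_trans qn)//.
by rewrite ltW//; near: n; exact: (near_infty_natSinv_lt (PosNum e0)).
Unshelve. all: by end_near. Qed.

Lemma uniform01_setT : (U setT < +oo)%E.
Proof. by rewrite probability_setT ltry. Qed.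

Lemma fine_uniform01_setT : fine (U setT) = 1.
Proof. by rewrite probability_setT. Qed.

Lemma disc_algebra_bounded_Re (F : C -> C) : disc_algebra F ->
  exists2 M : R, 0 < M & forall w : C, `|w| <= 1 -> `|complex.Re (F w)| <= M.
Proof.
move=> /disc_algebra_bounded[M M0 FM]; exists M => // w /FM.
by rewrite lecR; exact/le_trans/normr_Re.
Qed.

Lemma integrable_disc_algebra (F : C -> C) : disc_algebra F ->
  U.-integrable setT (EFin \o (fun x => complex.Re (F (circ x)))).
Proof.
move=> dF; have [M M0 FM] := disc_algebra_bounded_Re dF.
apply: (bounded_integrable measurableT uniform01_setT (M := M)).
  exact: measurable_Re_disc_algebra.
by move=> x _; apply: FM; rewrite normc_cis.
Qed.

Lemma eq_eps (a b K : R) : (forall e, 0 < e -> `|a - b| <= K * e) -> a = b.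
Proof.
move=> h; apply/eqP; rewrite -subr_eq0 -normr_eq0 eq_le normr_ge0 andbT.
apply/ler_addgt0Pl => e e0; rewrite addr0.
have K0 : 0 < `|K| + 1 by rewrite ltr_wpDl.
apply: le_trans (h (e / (`|K| + 1)) _) _; first by rewrite divr_gt0.
rewrite mulrCA ler_piMr//; first exact: ltW.
by rewrite ler_pdivrMr// mul1r (le_trans (ler_norm _))// lerDl.
Qed.

Lemma Rintegral_horner_circ (q : {poly C}) :
  \int[U]_x complex.Re q.[circ x] = complex.Re q.[0].
Proof.
under eq_Rintegral do rewrite Re_horner_circ.
rewrite Rintegral_sum//; last first.
  move=> i; apply: (@bounded_integrable _ _ _ _ _ measurableT uniform01_setT _ (Normc.normc q`_i)).
    rewrite (_ : (fun x => _) = (fun x : R => complex.Re (q`_i * cis ((2 * pi * i%:R) * x)))).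
      by apply: continuous_measurable_fun; exact: continuous_ReM_cis.
    by apply/funext => x; congr (complex.Re (_ * cis _)); ring.
  move=> x _; apply: (le_trans (normr_Re _)).
  by rewrite Normc.normcM (normc_eq1 (normc_cis _)) mulr1.
have [q0|] := posnP (size q).
  by move/eqP: q0; rewrite size_poly_eq0 => /eqP ->; rewrite size_poly0 big_ord0 horner0.
rewrite horner_coef0; case: (size q) => // n _.
rewrite big_ord_recl/= big1 ?addr0.
  under eq_Rintegral do rewrite mulr0 mulr0 /cis cos0 sin0 -[(1 +i* 0)%C]/(1 : C) mulr1.
  by rewrite Rintegral_cst// fine_uniform01_setT mulr1.
by move=> i _; rewrite Rintegral_ReM_cis.
Qed.

Lemma disc_algebra_mean (F : C -> C) : disc_algebra F ->
  \int[U]_x complex.Re (F (circ x)) = complex.Re (F 0).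
Proof.
(* One [e] for the integral over the circle, one for the value at 0. *)
move=> dF; apply: (@eq_eps _ _ 2) => e e0; have [q qF] := dF e e0.
have qF' (w : C) : `|w| <= 1 -> `|complex.Re (F w) - complex.Re q.[w]| <= e.
  by move=> /qF; rewrite lecR -raddfB; exact/le_trans/normr_Re.
set I := Rintegral _ _ _; rewrite -(subrK (complex.Re q.[0]) I) -addrA mulr_natl mulr2n.
rewrite (le_trans (ler_normD _ _))// lerD//; last first.
  by rewrite distrC qF'// normr0 ler01.
rewrite -Rintegral_horner_circ.
apply: le_trans (Rintegral_le_dist _ _ (e := e) _ _ _) _ => //.
- exact: uniform01_setT.
- exact: integrable_disc_algebra.
- exact: integrable_disc_algebra (disc_algebra_horner q).
- by move=> x _; apply: qF'; rewrite normc_cis.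
- by rewrite fine_uniform01_setT mulr1.
Qed.

Lemma measurable_pker_circ (w : C) : `|w| < 1 ->
  measurable_fun [set: mR] (fun x => pker w (circ x)).
Proof.
move=> w1; rewrite (_ : (fun x : mR => _) =
  (fun x => 2 * complex.Re (1 - w^*%C * circ x)^-1 - 1)); last first.
  by apply/funext => x; rewrite pker_Re// normc_cis.
have dF : disc_algebra (fun z => (1 - w^*%C * z)^-1).
  by apply: disc_algebra_geometric; rewrite normcJ.
apply: measurable_funB => //; apply: measurable_funM => //.
exact: (measurable_Re_disc_algebra dF).
Qed.

Lemma pker_bounded (w : C) : `|w| < 1 ->
  exists2 M : R, 0 < M & forall z : C, `|z| = 1 -> `|pker w z| <= M.
Proof.
move=> w1; have dF : disc_algebra (fun z => (1 - w^*%C * z)^-1).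
  by apply: disc_algebra_geometric; rewrite normcJ.
have [M M0 FM] := disc_algebra_bounded_Re dF.
exists (2 * M + 1) => [|z z1]; first by rewrite addr_gt0// mulr_gt0.
rewrite pker_Re// (le_trans (ler_normB _ _))// normr1 lerD2r normrM ger0_norm//.
by rewrite ler_pM2l// FM// z1.
Qed.

Lemma Re_realM (t : R) (z : C) : complex.Re (t%:C%C * z) = t * complex.Re z.
Proof. by case: z => x y /=; rewrite mul0r subr0. Qed.

(** Split [q = q(w) + (z - w) e(z)]. Against the kernel, the constant [r = Re q(w)] contributes
    [r Re ((1 + w^* z) / (1 - w^* z))]; in the rest the pole cancels, leaving
    [Re ((1 - |w|^2) z e(z) / (1 - w^* z))]. The sum is the real part of [a / b], analytic on the
    closed disc with value [r] at 0, and the mean value property concludes. *)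
Lemma Rintegral_pker_horner (q : {poly C}) (w : C) : `|w| < 1 ->
  \int[U]_x (pker w (circ x) * complex.Re q.[circ x]) = complex.Re q.[w].
Proof.
move=> w1; pose r : C := (complex.Re q.[w])%:C%C.
have /factor_theorem[e qe] : root (q - q.[w]%:P) w.
  by rewrite /root hornerD hornerN hornerC subrr.
pose b : {poly C} := 1 - w^*%C *: 'X.
pose a : {poly C} := r *: (1 + w^*%C *: 'X) + (1 - w * w^*%C) *: ('X * e).
have bE z : b.[z] = 1 - w^*%C * z by rewrite /b !hornerE.
have aE z : a.[z] = r * (1 + w^*%C * z) + (1 - w * w^*%C) * (z * e.[z]).
  by rewrite /a !hornerE.
have b0 (z : C) : `|z| <= 1 -> b.[z] != 0.
  by move=> z1; rewrite bE one_subM_neq0// normcJ.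
transitivity (\int[U]_x complex.Re (a.[circ x] / b.[circ x])).
  apply: eq_Rintegral => x _; set z := circ x.
  have z1 : `|z| = 1 by rewrite normc_cis.
  have qE : q.[z] = q.[w] + e.[z] * (z - w).
    by rewrite -hornerXsubC -hornerM -qe hornerD hornerN hornerC addrC subrK.
  have [d1 d2] := pker_neq0 w1 z1.
  have -> : a.[z] / b.[z] =
      r * (2 / (1 - w^*%C * z) - 1) + (1 - w * w^*%C) * (z / (1 - w^*%C * z)) * e.[z].
    by rewrite bE aE; field.
  rewrite -mulB_pker// (_ : (z - w) * _ * _ = (pker w z)%:C%C * (e.[z] * (z - w))); last first.
    by rewrite mulrAC mulrC [e.[z] * _]mulrC.
  rewrite raddfD/= !Re_realM.
  have -> : complex.Re (2 / (1 - w^*%C * z) - 1) = pker w z.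
    rewrite pker_Re// raddfB/=; congr (_ - _).
    by rewrite -[2 : C](rmorph_nat (real_complex R)) Re_realM.
  by rewrite qE raddfD/= [in RHS]mulrC mulrDr.
rewrite (disc_algebra_mean (disc_algebra_frac a b0)) bE aE.
by rewrite !mulr0 subr0 !addr0 mul0r mulr0 addr0 divr1 mulr1.
Qed.

Lemma poisson_disc_algebra (F : C -> C) (w : C) : disc_algebra F -> `|w| < 1 ->
  \int[U]_x (pker w (circ x) * complex.Re (F (circ x))) = complex.Re (F w).
Proof.
move=> dF w1; have [M M0 PM] := pker_bounded w1.
have ipF (G : C -> C) : disc_algebra G -> U.-integrable setT
    (EFin \o (fun x => pker w (circ x) * complex.Re (G (circ x)))).
  move=> dG; have [N N0 GN] := disc_algebra_bounded_Re dG.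
  apply: (bounded_integrable measurableT uniform01_setT (M := M * N)).
    apply: measurable_funM; first exact: measurable_pker_circ.
    exact: measurable_Re_disc_algebra.
  by move=> x _; rewrite normrM ler_pM ?PM ?GN// normc_cis.
(* [M * e] is the error under the kernel, which [M] bounds; the other [e] is the error at [w]. *)
apply: (@eq_eps _ _ (M + 1)) => e e0; have [q qF] := dF e e0.
have qF' (z : C) : `|z| <= 1 -> `|complex.Re (F z) - complex.Re q.[z]| <= e.
  by move=> /qF; rewrite lecR -raddfB; exact/le_trans/normr_Re.
set I := Rintegral _ _ _; rewrite -(subrK (complex.Re q.[w]) I) -addrA mulrDl mul1r.
rewrite (le_trans (ler_normD _ _))// lerD//; last first.
  by rewrite distrC qF'// ltW.
rewrite -Rintegral_pker_horner//.
apply: le_trans (Rintegral_le_dist _ _ (e := M * e) _ _ _) _ => //.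
- exact: uniform01_setT.
- exact: ipF.
- exact: ipF (disc_algebra_horner q).
- by move=> x _; rewrite -mulrBr normrM ler_pM ?PM ?qF' ?normc_cis.
- by rewrite fine_uniform01_setT mulr1.
Qed.

End circle_integral.

(** * Continuity, compactness and measurability on the torus *)

Section torus_topology.
Context {R : realType}.
Local Notation C := R[i].

Lemma cvg_row (T : Type) (F : set_system T) (FF : Filter F) d
    (f : T -> 'rV[C]_d) (l : 'rV[C]_d) :
  (forall j, f x 0 j @[x --> F] --> l 0 j) -> f @ F --> l.
Proof.
move=> fl; apply/cvg_ballP => e e0.
suff : \forall x \near F, forall j, ball (l 0 j) e (f x 0 j).
  apply: filterS => x fx; split => // i j; rewrite (ord1 i); exact: fx.
apply: filter_forall => j; have /cvg_ballP := fl j; exact.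
Qed.

Lemma continuous_row (T : topologicalType) d (f : T -> 'rV[C]_d) (x : T) :
  (forall j, {for x, continuous (fun y => f y 0 j)}) -> {for x, continuous f}.
Proof. by move=> fx; apply: cvg_row => j; exact: fx. Qed.

(** Norms in [C] are elements of [C], and so are the radii of balls; this passes from real estimates
    to that topology. *)
Lemma lipschitz1_continuous (f : C -> R) :
  (forall z w, `|f z - f w| <= Normc.normc (z - w)) -> continuous f.
Proof.
move=> fl z; apply/cvgrPdist_lt => [|e e0]; first exact: (@nbhs_filter C z).
apply/(@nbhs_ballP _ C); exists e%:C%C => /=; first by rewrite (ltcR 0).
by move=> w; rewrite -ball_normE/= ltcR; exact/le_lt_trans/fl.
Qed.

Lemma continuous_Re : continuous (@complex.Re R : C -> R).
Proof. by apply: lipschitz1_continuous => z w; rewrite -raddfB normr_Re. Qed.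

Lemma continuous_Im : continuous (@complex.Im R : C -> R).
Proof.
apply: lipschitz1_continuous => z w; rewrite -raddfB -normrN.
rewrite -[- _]ReiNIm (le_trans (normr_Re _))//.
by rewrite Normc.normcM [Normc.normc 'i%C](_ : _ = 1) ?mulr1//= expr0n/= add0r expr1n sqrtr1.
Qed.

Lemma normC_real (x : R) : `|x%:C%C : C| = `|x|%:C%C.
Proof. by rewrite normc_def/= expr0n/= addr0 sqrtr_sqr. Qed.

Lemma continuous_normc : continuous (@Normc.normc R : C -> R).
Proof.
apply: lipschitz1_continuous => z w; rewrite -lecR.
apply: le_trans (ler_dist_dist z w).
rewrite [leRHS](_ : _ = `|Normc.normc z - Normc.normc w|%:C%C)//.
by rewrite -normC_real rmorphB.
Qed.

Lemma continuous_pker (w z : C) : z != w -> {for z, continuous (pker w)}.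
Proof.
move=> zw; have FF : Filter (nbhs z) := @nbhs_filter C z.
rewrite /continuous_at /pker; apply: cvgM; first exact: cvg_cst.
have n0 : Normc.normc (z - w) ^+ 2 != 0.
  by rewrite expf_neq0// gt_eqF// normc_gt0 subr_eq0.
apply: cvgV => //.
have : (fun y : C => Normc.normc (y - w)) y @[y --> z] --> Normc.normc (z - w).
  apply: (@continuous_comp _ _ _ (fun y : C => y - w)); last exact: continuous_normc.
  by apply: cvgB; [exact: cvg_id|exact: cvg_cst].
by move=> h; apply: cvgM; exact: h.
Qed.

(** Exhibits the circle as a continuous image of a segment, for its compactness. *)
Lemma circle_cis : [set z : C | `|z| = 1] = cis @` `[- pi, pi]%classic.
Proof.
apply/seteqP; split => [[a b]/=|_ [x _ <-]]; last exact: normc_cis.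
rewrite normc_def/= => /(@complexI R) /eqP.
rewrite -(@sqrtr1 R) eqr_sqrt ?addr_ge0 ?sqr_ge0// => /eqP ab.
have a1 : -1 <= a <= 1.
  rewrite -ler_norml -(@ler_pXn2r _ 2)// ?nnegrE//.
  by rewrite real_normK ?num_real// expr1n -ab lerDl sqr_ge0.
have ca : cos (acos a) = a by rewrite acosK// in_itv.
have sa : sin (acos a) = `|b|.
  by rewrite sin_acos// -ab addrC addKr sqrtr_sqr.
have a0 := acos_ge0 a1; have ap := acos_lepi a1; have p0 := pi_ge0 R.
have [b0|b0] := leP 0 b.
  exists (acos a); last by rewrite /cis ca sa ger0_norm.
  by rewrite /= in_itv/= ap (le_trans _ a0)// oppr_le0.
exists (- acos a); last by rewrite /cis cosN sinN ca sa ltr0_norm// opprK.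
by rewrite /= in_itv/= lerN2 ap (le_trans _ p0)// oppr_le0.
Qed.

Lemma compact_circle : compact [set z : C | `|z| = 1].
Proof.
rewrite circle_cis; apply: continuous_compact; last exact: segment_compact.
exact/continuous_subspaceT/continuous_cis.
Qed.

Lemma compact_torus d : compact (torus : set 'rV[C]_d).
Proof. exact: (@rV_compact _ _ (fun=> [set z : C | `|z| = 1]) (fun=> compact_circle)). Qed.

Lemma closed_torus d : closed (torus : set 'rV[C]_d).
Proof.
rewrite (_ : torus = \bigcap_(j in setT) [set z : 'rV[C]_d | `|z 0 j| = 1]).
  apply: closed_bigI => j _.
  apply: (@preimage_closed _ _ (fun z : 'rV[C]_d => z 0 j) [set z : C | `|z| = 1]).
    by move=> z _; exact: coord_continuous.
  exact: (compact_closed (@norm_hausdorff _ C) compact_circle).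
by apply/seteqP; split => [z zt j _|z zt j]; apply: zt.
Qed.

Lemma measurable_torus d : measurable (torus : set (borel 'rV[C]_d)).
Proof.
rewrite -[torus]setCK; apply: measurableC; apply: sub_sigma_algebra.
exact/closed_openC/closed_torus.
Qed.

(** [h] is controlled on the torus only and need not be Borel on [C^d]. The preimage of an interval
    by [h] agrees on the torus with an open set [V], and since [phi] stays in the torus it suffices
    to pull [V] back. *)
Lemma measurable_within_torus d (h : 'rV[C]_d -> R) disp (T : measurableType disp)
    (D : set T) (phi : T -> 'rV[C]_d) :
  {within torus, continuous h} ->
  measurable_fun D (phi : T -> borel 'rV[C]_d) -> (forall x, D x -> torus (phi x)) ->
  measurable_fun D (h \o phi).
Proof.
move=> /continuousP ch mphi phit mD.
apply: (measurability _ (RGenOpens.measurableE R)) => //.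
move=> _ [_ [a [b ->] <-]].
have oab : open (`]a, b[%classic : set R) by exact: interval_open.
have /open_subspaceP[V oV VE] := ch _ oab.
rewrite (_ : _ `&` _ = D `&` phi @^-1` V).
  by apply: mphi => //; apply: sub_sigma_algebra.
apply/seteqP; split => x [Dx /= hx]; split => //=.
  have : (V `&` torus) (phi x) by rewrite VE; split => //; exact: phit.
  by case.
have : (h @^-1` `]a, b[%classic `&` torus) (phi x).
  by rewrite -VE; split => //; exact: phit.
by case.
Qed.

Lemma bounded_within_torus d (h : 'rV[C]_d -> R) : {within torus, continuous h} ->
  exists2 M : R, 0 < M & forall z, torus z -> `|h z| <= M.
Proof.
move=> ch; have /compact_bounded[M [Mr hM]] : compact (h @` torus).
  by apply: continuous_compact => //; exact: compact_torus.
exists (`|M| + 1); first by rewrite ltr_wpDl.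
move=> z zt; apply: hM; last by exists z.
by rewrite ltr_pwDr// ler_norm.
Qed.

End torus_topology.

(** * The Poisson formula on the polydisc *)

Section polydisc_poisson.
Context {R : realType}.
Local Notation C := R[i].
Local Notation mR := (measurableTypeR R).
Local Notation U := (uniform_prob (@ltr01 R)).
Local Notation circ x := (cis (2 * pi * x : R)).

(** The new coordinate comes in front, as in [tcons], to follow the recursion that defines
    [cube_measure]; [snoc] adds it at the end. *)
Definition rcons_row n (w : C) (z : 'rV[C]_n) : 'rV[C]_n.+1 :=
  \row_i (if unlift ord0 i is Some j then z 0 j else w).

Definition upd n (z : 'rV[C]_n) (i : 'I_n) (w : C) : 'rV[C]_n :=
  \row_j (if j == i then w else z 0 j).

Lemma rcons_row0 n (w : C) (z : 'rV[C]_n) : rcons_row w z 0 ord0 = w.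
Proof. by rewrite mxE unlift_none. Qed.

Lemma rcons_rowS n (w : C) (z : 'rV[C]_n) j : rcons_row w z 0 (lift ord0 j) = z 0 j.
Proof. by rewrite mxE liftK. Qed.

Lemma forall_rcons_row n (P : C -> Prop) (w : C) (z : 'rV[C]_n) :
  P w -> (forall j, P (z 0 j)) -> forall j, P (rcons_row w z 0 j).
Proof.
by move=> Pw Pz j; case: (unliftP ord0 j) => [k|] ->; rewrite ?rcons_rowS ?rcons_row0.
Qed.

Lemma torus_param_tcons n (x : mR) (s : n.-tuple mR) :
  torus_param (tcons (x, s)) = rcons_row (circ x) (torus_param s).
Proof.
apply/rowP => j; case: (unliftP ord0 j) => [k|] ->.
  by rewrite rcons_rowS !mxE tnthS.
by rewrite rcons_row0 mxE tnth0.
Qed.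

Lemma torus_param_torus n (s : n.-tuple mR) : torus (torus_param s).
Proof. by move=> j; rewrite mxE normc_cis. Qed.

Lemma torus_closed_polydisc n (z : 'rV[C]_n) : torus z -> closed_polydisc z.
Proof. by move=> zt j; rewrite zt. Qed.

Lemma polydisc_closed_polydisc n (z : 'rV[C]_n) : polydisc z -> closed_polydisc z.
Proof. by move=> zt j; exact: ltW. Qed.

Lemma rcons_row_upd n (w v : C) (z : 'rV[C]_n) i :
  rcons_row w (upd z i v) = upd (rcons_row w z) (lift ord0 i) v.
Proof.
apply/rowP => j; case: (unliftP ord0 j) => [k|] ->.
  by rewrite rcons_rowS !mxE (inj_eq (@lift_inj _ _)) liftK.
by rewrite rcons_row0 !mxE (negbTE (neq_lift _ _)) unlift_none.
Qed.

Lemma rcons_row_upd0 n (w v : C) (z : 'rV[C]_n) :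
  rcons_row v z = upd (rcons_row w z) ord0 v.
Proof.
apply/rowP => j; case: (unliftP ord0 j) => [k|] ->.
  by rewrite rcons_rowS mxE eq_sym (negbTE (neq_lift _ _)) rcons_rowS.
by rewrite rcons_row0 !mxE eqxx.
Qed.

Lemma rcons_row_eta n (z : 'rV[C]_n.+1) :
  z = rcons_row (z 0 ord0) (\row_j z 0 (lift ord0 j)).
Proof.
apply/rowP => j; case: (unliftP ord0 j) => [k|] ->.
  by rewrite rcons_rowS mxE.
by rewrite rcons_row0.
Qed.

Lemma poisson_rcons_row n (w v : C) (z y : 'rV[C]_n) :
  poisson (rcons_row w z) (rcons_row v y) = pker w v * poisson z y.
Proof.
rewrite /poisson big_ord_recl !rcons_row0; congr (_ * _).
by apply: eq_bigr => j _; rewrite !rcons_rowS.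
Qed.

Lemma continuous_rcons_row n (w : C) : continuous (@rcons_row n w).
Proof.
move=> z; apply: continuous_row => j; case: (unliftP ord0 j) => [k|] ->.
  under [X in {for _, continuous X}]eq_fun do rewrite rcons_rowS.
  exact: coord_continuous.
under [X in {for _, continuous X}]eq_fun do rewrite rcons_row0.
exact: cst_continuous.
Qed.

(** Stands for analyticity on the closed polydisc, one variable at a time, with no uniformity in the
    other variables. *)
Definition separately_disc_algebra n (F : 'rV[C]_n -> C) :=
  forall z i, closed_polydisc z -> disc_algebra (fun w => F (upd z i w)).

Lemma cvg_prod_seq (K : numFieldType) (T : Type) (F : set_system T) (FF : Filter F)
    I (s : seq I) (f : I -> T -> K) (l : I -> K) :
  (forall i, f i x @[x --> F] --> l i) ->
  (\prod_(i <- s) f i x) @[x --> F] --> \prod_(i <- s) l i.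
Proof.
move=> fl; elim: s => [|i s ih].
  rewrite big_nil; under [X in X @ _]eq_fun do rewrite big_nil.
  exact: cvg_cst.
rewrite big_cons; under [X in X @ _]eq_fun do rewrite big_cons.
exact: cvgM.
Qed.

Lemma continuous_poisson n (z y : 'rV[C]_n) : polydisc z -> torus y ->
  {for y, continuous (poisson z)}.
Proof.
move=> zd yt; apply: (cvg_prod_seq (@nbhs_filter 'rV[C]_n y)) => j.
have yz : y 0 j != z 0 j.
  rewrite eq_sym; apply: contraTneq (zd j) => ->; by rewrite yt ltxx.
apply: (@continuous_comp _ _ _ (fun y : 'rV[C]_n => y 0 j) (pker (z 0 j))).
  exact: coord_continuous.
exact: continuous_pker.
Qed.

Lemma within_torus_continuous n (T : topologicalType) (f : 'rV[C]_n -> T) :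
  (forall y, torus y -> {for y, continuous f}) -> {within torus, continuous f}.
Proof. by move=> cf; apply: continuous_in_subspaceT => y /set_mem; exact: cf. Qed.

Lemma within_continuous_poisson n (z : 'rV[C]_n) : polydisc z ->
  {within torus, continuous (poisson z)}.
Proof.
by move=> zd; apply: within_torus_continuous => y; exact: continuous_poisson.
Qed.

Lemma probability_lty d1 (T1 : measurableType d1) (P : probability T1 R) :
  (P setT < +oo)%E.
Proof. by rewrite probability_setT ltry. Qed.

Lemma Rintegral_prod d1 d2 (T1 : measurableType d1) (T2 : measurableType d2)
    (P1 : probability T1 R) (P2 : probability T2 R) (f : T1 * T2 -> R) (M : R) :
  measurable_fun setT f -> (forall x, `|f x| <= M) ->
  \int[(P1 \x P2)%E]_x f x = \int[P1]_x \int[P2]_y f (x, y).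
Proof.
move=> mf fM.
have fi : (P1 \x P2)%E.-integrable setT (EFin \o f).
  apply: (bounded_integrable measurableT _ mf (fun x _ => fM x)).
  exact: (probability_lty (P1 \x P2)%E).
rewrite /Rintegral -(integral12_prod_meas1 fi); congr fine.
apply: eq_integral => x _; rewrite fineK//.
have mfx : measurable_fun setT (fun y => f (x, y)).
  exact: measurableT_comp.
have : P2.-integrable setT (EFin \o (fun y => f (x, y))).
  apply: (bounded_integrable measurableT _ mfx (fun y _ => fM (x, y))).
  exact: probability_lty.
exact: integrable_fin_num.
Qed.

Lemma Rintegral_distribution d1 d2 (T1 : measurableType d1) (T2 : measurableType d2)
    (P : probability T1 R) (X : {RV P >-> T2}) (f : T2 -> R) (M : R) :
  measurable_fun setT f -> (forall x, `|f x| <= M) ->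
  \int[distribution P X]_x f x = \int[P]_x f (X x).
Proof.
move=> mf fM; rewrite /Rintegral integral_distribution//.
  exact/measurable_EFinP.
apply: (bounded_integrable measurableT _ _ (fun x _ => fM (X x))).
  exact: probability_lty.
exact: (measurableT_comp mf).
Qed.

Lemma poisson_cube_tools n (F : 'rV[C]_n -> C) (z : 'rV[C]_n) : polydisc z ->
    (forall y, closed_polydisc y -> {for y, continuous F}) ->
  let G y := poisson z y * complex.Re (F y) in
  measurable_fun [set: n.-tuple mR] (fun t => G (torus_param t)) /\
  exists M, forall t : n.-tuple mR, `|G (torus_param t)| <= M.
Proof.
move=> zd cF G.
have cG : {within torus, continuous G}.
  apply: within_torus_continuous => y yt.
  apply: (@cvgM _ _ (nbhs y) (@nbhs_filter 'rV[C]_n y)).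
    exact: continuous_poisson.
  apply: (@continuous_comp _ _ _ F); last exact: continuous_Re.
  exact/cF/torus_closed_polydisc.
have [M M0 GM] := bounded_within_torus cG.
split; last by exists M => t; exact/GM/torus_param_torus.
apply: (measurable_within_torus cG); first exact: measurable_torus_param.
by move=> t _; exact: torus_param_torus.
Qed.

(** Fubini and induction on the dimension: with the first coordinate on the circle, the induction
    hypothesis integrates out the others, and the one-variable formula then moves the first
    coordinate inside the disc. Joint continuity provides measurability and boundedness. *)
Lemma poisson_cube n (F : 'rV[C]_n -> C) (z : 'rV[C]_n) : polydisc z ->
  separately_disc_algebra F ->
  (forall y, closed_polydisc y -> {for y, continuous F}) ->
  \int[cube_measure n]_t (poisson z (torus_param t) * complex.Re (F (torus_param t))) =
  complex.Re (F z).
Proof.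
elim: n F z => [|n ih] F z zd dF cF.
  have [mG _] := poisson_cube_tools zd cF.
  rewrite /Rintegral integral_dirac//=; last exact/measurable_EFinP.
  rewrite indicT mul1r /poisson big_ord0 mul1r.
  by congr (complex.Re (F _)); apply/rowP => -[].
have [mG [M bG]] := poisson_cube_tools zd cF.
rewrite (Rintegral_distribution _ mG bG).
rewrite (Rintegral_prod _ _ (measurableT_comp mG (@measurable_tcons _ n))
  (fun x => bG (tcons x))) -/(cube_measure n).
rewrite [in RHS](rcons_row_eta z); set z' := \row_j _.
have z'd : polydisc z' by move=> j; rewrite mxE.
have c1 (w : C) : `|w| <= 1 -> forall y : 'rV[C]_n, closed_polydisc y ->
    closed_polydisc (rcons_row w y).
  by move=> w1 y yd; apply: (forall_rcons_row (P := fun v => `|v| <= 1)).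
transitivity (\int[U]_x (pker (z 0 ord0) (circ x) * complex.Re (F (rcons_row (circ x) z')))).
  apply: eq_Rintegral => x _.
  have x1 : `|circ x| = 1 by exact: normc_cis.
  have cFx (y : 'rV[C]_n) : closed_polydisc y ->
      {for y, continuous (fun y => F (rcons_row (circ x) y))}.
    move=> yd; apply: (@continuous_comp _ _ _ (rcons_row (circ x)) F).
      exact: continuous_rcons_row.
    by apply: cF; apply: c1 => //; rewrite x1.
  rewrite -(ih (fun y => F (rcons_row (circ x) y)) z' z'd); first last.
  - exact: cFx.
  - move=> y i yd; apply: disc_algebra_ext (dF (rcons_row (circ x) y) (lift ord0 i) _).
      by move=> w w1; rewrite rcons_row_upd.
    by apply: c1 => //; rewrite x1.
  rewrite -RintegralZl//.
    apply: eq_Rintegral => s _; rewrite /= torus_param_tcons {1}(rcons_row_eta z).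
    by rewrite poisson_rcons_row mulrA.
  have [mGx [N bGx]] := poisson_cube_tools z'd cFx.
  apply: (bounded_integrable measurableT _ mGx (fun t _ => bGx t)).
  exact: probability_lty.
rewrite (poisson_disc_algebra (F := fun w => F (rcons_row w z'))) ?zd//.
apply: disc_algebra_ext (dF (rcons_row 0 z') ord0 _).
  by move=> w w1; rewrite -rcons_row_upd0.
by apply: c1; rewrite ?normr0//; exact: polydisc_closed_polydisc.
Qed.

End polydisc_poisson.

(** * Integration on the torus and measurability by coordinates *)

Section torus_integral.
Context {R : realType}.
Local Notation C := R[i].
Local Notation mR := (measurableTypeR R).

Lemma Rintegral_torus n (h : 'rV[C]_n -> R) : {within torus, continuous h} ->
  \int[torus_measure n]_(y in torus) h y =
  \int[cube_measure n]_t h (torus_param t).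
Proof.
move=> ch; have [M M0 hM] := bounded_within_torus ch.
have mt := @measurable_torus R n.
have mh : measurable_fun (torus : set (borel 'rV[C]_n)) h.
  apply: (@measurable_within_torus _ _ _ _ (borel 'rV[C]_n) _ id ch) => //.
(* [h] may be arbitrary off the torus, so it is replaced by 0 there before the change of
   variables. *)
rewrite Rintegral_mkcond (@Rintegral_distribution R _ _ _ (borel 'rV[C]_n) _ _ (h \_ torus) M).
- apply: eq_Rintegral => t _; rewrite patchE mem_set//; exact: torus_param_torus.
- exact/(measurable_restrictT _ mt).
- move=> y; rewrite patchE; case: ifPn => [/set_mem|_]; first exact: hM.
  by rewrite normr0 ltW.
Qed.

Lemma poisson_torus n (F : 'rV[C]_n -> C) (z : 'rV[C]_n) : polydisc z ->
  separately_disc_algebra F ->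
  (forall y, closed_polydisc y -> {for y, continuous F}) ->
  \int[torus_measure n]_(y in torus) (poisson z y * complex.Re (F y)) =
  complex.Re (F z).
Proof.
move=> zd dF cF; rewrite Rintegral_torus ?poisson_cube//.
apply: within_torus_continuous => y yt.
apply: (@cvgM _ _ (nbhs y) (@nbhs_filter 'rV[C]_n y)).
  exact: continuous_poisson.
apply: (@continuous_comp _ _ _ F); last exact: continuous_Re.
exact/cF/torus_closed_polydisc.
Qed.

Lemma normc_le_ReIm (z : C) : Normc.normc z <= `|complex.Re z| + `|complex.Im z|.
Proof.
case: z => a b /=; rewrite -(@ler_pXn2r _ 2)// ?nnegrE ?sqrtr_ge0 ?addr_ge0//.
rewrite sqr_sqrtr ?addr_ge0 ?sqr_ge0// sqrrD !real_normK ?num_real//.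
by rewrite addrAC lerDl mulrn_wge0 ?mulr_ge0.
Qed.

(** Every open set of [C^n] is a countable union of boxes with rational corners, so Borel
    measurability can be tested on coordinates. This makes the graph of a measurable branch
    measurable. *)
Lemma measurable_row n disp (T : measurableType disp) (D : set T) (f : T -> 'rV[C]_n) :
  (forall j, measurable_fun D (fun x => f x 0 j : borel C)) ->
  measurable_fun D (f : T -> borel 'rV[C]_n).
Proof.
move=> mf mD.
pose box (q : rat * rat * (rat * rat)) : set C :=
  [set z | ratr q.1.1 < complex.Re z < ratr q.1.2 /\ ratr q.2.1 < complex.Im z < ratr q.2.2].
have obox q : open (box q).
  rewrite (_ : box q = (@complex.Re R : C -> R) @^-1` `](ratr q.1.1), (ratr q.1.2)[%classic `&`
                       (@complex.Im R : C -> R) @^-1` `](ratr q.2.1), (ratr q.2.2)[%classic).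
    apply: openI; apply: open_comp => [z _|]; [exact: continuous_Re| |exact: continuous_Im|];
      exact: interval_open.
  by apply/seteqP; split => z /=; rewrite !in_itv.
have ratb (x e : R) : 0 < e ->
    exists2 q : rat * rat, ratr q.1 < x < ratr q.2 &
      forall y, ratr q.1 < y < ratr q.2 -> `|x - y| < e.
  move=> e0; have /rat_in_itvoo[q1 q1P] : x - e < x by rewrite ltrBlDr ltrDl.
  have /rat_in_itvoo[q2 q2P] : x < x + e by rewrite ltrDl.
  move: q1P q2P; rewrite !in_itv/= => /andP[a1 a2] /andP[b1 b2].
  exists (q1, q2) => [/=|y /= /andP[c1 c2]]; first by rewrite a2.
  by rewrite ltr_distlC (lt_trans a1 c1) (lt_trans c2 b2).
apply: (@measurability _ _ _ (borel 'rV[C]_n) _ _ (@open 'rV[C]_n)) => // _ [V oV <-].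
pose Box (q : n.-tuple (rat * rat * (rat * rat))) : set 'rV[C]_n :=
  [set y | forall j, box (tnth q j) (y 0 j)].
have VBox y : V y -> exists2 q, Box q y & Box q `<=` V.
  move=> Vy; have /nbhs_ballP[e /= e0 eV] : nbhs y V by exact: open_nbhs_nbhs.
  have eE : e = (complex.Re e)%:C%C by rewrite RRe_real// gtr0_real.
  have e0' : 0 < complex.Re e / 2.
    by rewrite divr_gt0// -(ltcR 0 (complex.Re e)) -eE.
  have /choice[q qP] : forall j : 'I_n, exists q : rat * rat * (rat * rat),
      box q (y 0 j) /\ forall z, box q z -> `|y 0 j - z| < e.
    move=> j; have [q1 q1P q1e] := ratb (complex.Re (y 0 j)) _ e0'.
    have [q2 q2P q2e] := ratb (complex.Im (y 0 j)) _ e0'.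
    exists (q1, q2); split => // z [/q1e z1 /q2e z2].
    rewrite eE ltcR (le_lt_trans (normc_le_ReIm _))// (splitr (complex.Re e)).
    by rewrite ltrD// raddfB.
  exists [tuple q j | j < n] => [j|z qz]; first by rewrite tnth_mktuple; have [] := qP j.
  apply: eV; split => // i j; rewrite (ord1 i) -ball_normE/=.
  by have [_] := qP j; apply; have := qz j; rewrite tnth_mktuple.
rewrite (_ : _ `&` _ = \bigcup_(q in [set q | Box q `<=` V]) (D `&` f @^-1` Box q)); last first.
  apply/seteqP; split => [x [Dx /VBox[q qx qV]]|x [q qV [Dx qx]]]; first by exists q.
  by split => //; exact: qV.
rewrite bigcup_mkcond; apply: countable_bigcupT_measurable => [|q]; first exact: countableP.
case: ifPn => // _.
rewrite (_ : _ `&` _ = D `&` \bigcap_(j in [set: 'I_n])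
    (D `&` (fun x => f x 0 j) @^-1` box (tnth q j))).
  apply: measurableI => //; apply: fin_bigcap_measurable => // j _.
  by apply: mf => //; exact: sub_sigma_algebra.
apply/seteqP; split => [x [Dx qx]|x [Dx qx]]; split => //; first by move=> j _; split => //; exact: qx.
by move=> j; have [_ ?] := qx j I.
Qed.

End torus_integral.

(** * Density of the Poisson kernels *)

Section roots_of_unity.
Context {R : realType}.
Local Notation C := R[i].

Definition uroot N (k : nat) : C := cis (2 * pi * (k%:R / N%:R)).

Lemma uroot_norm N k : `|uroot N k| = 1.
Proof. exact: normc_cis. Qed.

Lemma urootX N k l : uroot N k ^+ l = uroot N l ^+ k.
Proof. by rewrite !cisX; congr cis; ring. Qed.

Lemma uroot_expN N k : (0 < N)%N -> uroot N k ^+ N = 1.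
Proof.
move=> N0; rewrite cisX -(circ_natM k); congr cis.
by field; rewrite pnatr_eq0 -lt0n.
Qed.

Lemma cis_neq1 (x : R) : 0 < x < 2 * pi -> cis x != 1.
Proof.
move=> /andP[x0 x1]; apply/eqP => -[cx _].
have : 0 < sin (x / 2).
  by rewrite sin_gt0_pi// divr_gt0//= ltr_pdivrMr// mulrC.
have := cx; rewrite [x in cos x](splitr x) cosD -!expr2 => h.
have := cos2Dsin2 (x / 2) => h2 s0.
have : sin (x / 2) ^+ 2 = 0 by lra.
by move/eqP; rewrite sqrf_eq0 gt_eqF.
Qed.

(** Exchanging the roles of [k] and [l] gives a geometric series whose ratio [uroot N l] is an N-th
    root of unity other than 1. *)
Lemma sum_urootX N l : (0 < l < N)%N -> \sum_(k < N) uroot N k ^+ l = 0.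
Proof.
move=> /andP[l0 lN]; have N0 := ltn_trans l0 lN.
under eq_bigr do rewrite urootX.
have := subrX1 (uroot N l) N; rewrite uroot_expN// subrr => /esym/eqP.
rewrite mulf_eq0 => /orP[|/eqP//]; rewrite subr_eq0 => /negPn/negP[].
have p0 : 0 < 2 * pi :> R by rewrite mulr_gt0// pi_gt0.
apply: cis_neq1; rewrite mulr_gt0//=; last by rewrite divr_gt0// ltr0n.
by rewrite gtr_pMr// ltr_pdivrMr ?ltr0n// mul1r ltr_nat.
Qed.

(** Multiplying by [1 - x^N] turns each term into the sum of [(x * uroot N k)^l] over [l < N];
    summing over [k] kills every [l] but 0. *)
Lemma sum_geometric_uroot N (x : C) : (0 < N)%N -> `|x| < 1 ->
  \sum_(k < N) (1 - x * uroot N k)^-1 = N%:R / (1 - x ^+ N).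
Proof.
move=> N0 x1.
have xN : 1 - x ^+ N != 0.
  rewrite -[x ^+ N]mulr1 one_subM_neq0 ?normr1// normrX exprn_ilt1//.
  by rewrite -lt0n.
transitivity (\sum_(k < N) (\sum_(l < N) (x * uroot N k) ^+ l) / (1 - x ^+ N)).
  apply: eq_bigr => k _; have k1 : 1 - x * uroot N k != 0.
    by rewrite one_subM_neq0 ?uroot_norm.
  have := subrX1 (x * uroot N k) N; rewrite exprMn uroot_expN// mulr1.
  set s := \sum_(l < N) _ => h.
  have -> : 1 - x ^+ N = (1 - x * uroot N k) * s.
    by rewrite -[LHS]opprB h -mulNr opprB.
  have s0 : s != 0.
    by apply: contra_neq xN => s0; rewrite -[LHS]opprB h s0 mulr0 oppr0.
  by field; rewrite s0 k1.
rewrite -mulr_suml exchange_big /=; congr (_ / _).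
rewrite -(prednK N0) big_ord_recl/= [X in _ + X]big1 ?addr0.
  under eq_bigr do rewrite expr0.
  by rewrite sumr_const card_ord.
move=> i _; under eq_bigr do rewrite exprMn.
rewrite -mulr_sumr (prednK N0) sum_urootX ?mulr0//.
by rewrite /bump leq0n add1n ltn0Sn /= -[X in (_ < X)%N](prednK N0) ltnS.
Qed.

(* The average over the N-th roots of unity of the Poisson kernels with poles
   on the circle of radius r is the Poisson kernel of radius r^N evaluated at z^N. *)
Lemma pker_average N (r : R) (z : C) : (0 < N)%N -> 0 <= r < 1 -> `|z| = 1 ->
  `|\sum_(k < N) N%:R^-1 * pker (r%:C%C * uroot N k) z - 1| <=
    2 * (r ^+ N / (1 - r ^+ N)).
Proof.
move=> N0 /andP[r0 r1] z1; pose x : C := r%:C%C * z^*%C.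
have nx : Normc.normc x = r.
  apply: (@complexI R); rewrite -normC_normc normrM normcJ z1 mulr1.
  by rewrite normC_real ger0_norm.
have x1 : `|x| < 1 by rewrite -normc_lt1 nx.
have xN1 : r ^+ N < 1 by rewrite exprn_ilt1// -lt0n.
have NR0 : N%:R != 0 :> R by rewrite pnatr_eq0 -lt0n.
have xN : 1 - x ^+ N != 0.
  rewrite -[x ^+ N]mulr1 one_subM_neq0 ?normr1// normrX exprn_ilt1//.
  by rewrite -lt0n.
have pk (k : 'I_N) : pker (r%:C%C * uroot N k) z =
    2 * complex.Re (1 - x * uroot N k)^-1 - 1.
  rewrite pker_Re//; last by rewrite normrM uroot_norm mulr1 normC_real ger0_norm// (ltcR _ 1).
  congr (2 * _ - 1); rewrite -[RHS](_ : complex.Re ((1 - x * uroot N k)^-1)^*%C = _); last first.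
    by case: (_^-1).
  rewrite conjc_inv; congr (complex.Re _^-1).
  rewrite rmorphB rmorphM [X in _ = X - _]conjc1; congr (_ - _).
  by rewrite /x !rmorphM /= [X in _ = _ * X * _](conjcK z) mulrAC.
under eq_bigr do rewrite pk.
rewrite -mulr_sumr sumrB -mulr_sumr -Re_sum sum_geometric_uroot//.
rewrite sumr_const card_ord.
have -> : complex.Re (N%:R / (1 - x ^+ N)) = N%:R * complex.Re (1 - x ^+ N)^-1.
  by rewrite -Re_realM rmorph_nat.
have -> : N%:R^-1 * (2 * (N%:R * complex.Re (1 - x ^+ N)^-1) - N%:R) - 1 =
    2 * complex.Re (x ^+ N / (1 - x ^+ N)) :> R.
  have -> : x ^+ N / (1 - x ^+ N) = (1 - x ^+ N)^-1 - 1 by field.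
  rewrite raddfB/=; by field.
rewrite normrM ger0_norm// ler_pM2l// (le_trans (normr_Re _))//.
rewrite Normc.normcM Normc.normcV.
have nxN : Normc.normc (x ^+ N) = r ^+ N.
  apply: (@complexI R); rewrite -normC_normc normrX normC_normc nx.
  by rewrite rmorphXn.
rewrite nxN ler_wpM2l ?exprn_ge0// lef_pV2 ?posrE ?subr_gt0 ?normc_gt0//.
rewrite -lecR -normC_normc (le_trans _ (lerB_dist _ _))// normr1.
by rewrite normC_normc nxN rmorphB.
Qed.

(** Both [|w - z| <= |z - r w| + (1 - r)] and [1 - r <= |z - r w|] hold, so [|w - z|] is at most
    twice the distance in the denominator of the kernel. *)
Lemma pker_uroot_sqr (r : R) (z w : C) : 0 <= r < 1 -> `|z| = 1 -> `|w| = 1 ->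
  pker (r%:C%C * w) z * Normc.normc (w - z) ^+ 2 <= 4 * (1 - r ^+ 2).
Proof.
move=> /andP[r0 r1] z1 w1; rewrite /pker Normc.normcM (normc_eq1 w1) mulr1.
have nr : Normc.normc r%:C%C = r.
  by apply: (@complexI R); rewrite -normC_normc normC_real ger0_norm.
rewrite nr; set a := Normc.normc (z - _); set b := Normc.normc (w - z).
have ha : 1 - r <= a.
  rewrite -lecR -normC_normc (le_trans _ (lerB_dist _ _))// z1 normrM w1 mulr1.
  by rewrite normC_real ger0_norm// rmorphB.
have a0 : 0 < a by rewrite (lt_le_trans _ ha)// subr_gt0.
have hb : b <= a + (1 - r).
  rewrite /b (_ : w - z = - (z - r%:C%C * w) + (1 - r)%:C%C * w); last first.
    by rewrite rmorphB; ring.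
  rewrite (le_trans (le_normcD _ _))// normcN lerD// Normc.normcM (normc_eq1 w1) mulr1.
  rewrite -lecR -normC_normc normC_real ger0_norm// subr_ge0 ltW//.
have b0 : 0 <= b by exact: normc_ge0.
have b2 : b ^+ 2 <= 4 * a ^+ 2 by nra.
rewrite mulrAC -mulrA mulrC ler_wpM2r//.
  by rewrite subr_ge0 expr_le1// ltW.
by rewrite ler_pdivrMr// exprn_gt0.
Qed.

End roots_of_unity.

Section poisson_approximation.
Context {R : realType}.
Local Notation C := R[i].

Lemma torus_unif_continuous n (f : 'rV[C]_n -> R) (e : R) :
  {within torus, continuous f} -> 0 < e ->
  exists2 d : R, 0 < d & forall y z : 'rV[C]_n, torus y -> torus z ->
    (forall j, Normc.normc (y 0 j - z 0 j) < d) -> `|f y - f z| < e.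
Proof.
move=> /subspace_continuousP cf e0.
pose P (d : R) (z : 'rV[C]_n) := forall y : 'rV[C]_n, torus y ->
    (forall j, Normc.normc (y 0 j - z 0 j) < d) -> `|f y - f z| < e.
have /near_covering_withinP nc : near_covering (torus : set 'rV[C]_n).
  by apply/compact_near_coveringP; exact: compact_torus.
have : \forall d \near (0 : R)^'+, torus `<=` P d.
  apply: nc => z0 z0t.
  have FF : Filter (within torus (nbhs z0)).
    by apply: within_filter; exact: (@nbhs_filter 'rV[C]_n z0).
  have /cvgrPdist_lt /(_ (e / 2)) := cf _ z0t.
  rewrite divr_gt0// => /(_ isT); rewrite near_withinE => /nbhs_ballP[r /= r0 rP].
  have rE : r = (complex.Re r)%:C%C by rewrite RRe_real// gtr0_real.
  have r0' : 0 < complex.Re r / 2.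
    by rewrite divr_gt0// -(ltcR 0 (complex.Re r)) -rE.
  have fr (y : 'rV[C]_n) : torus y ->
      (forall j, Normc.normc (z0 0 j - y 0 j) < complex.Re r) -> `|f z0 - f y| < e / 2.
    move=> yt yr; apply: rP => //; split => // i j.
    by rewrite (ord1 i) -ball_normE/= rE ltcR.
  exists ([set z : 'rV[C]_n | forall j, Normc.normc (z0 0 j - z 0 j) < complex.Re r / 2],
          [set d : R | d < complex.Re r / 2]) => /=.
    split; last exact: nbhs_right_lt.
    apply/(@nbhs_ballP _ 'rV[C]_n); exists (complex.Re r / 2)%:C%C => /=.
      by rewrite (ltcR 0).
    move=> z [_ zr] j; have := zr 0 j; rewrite -ball_normE/= ltcR//.
  move=> [z d] /= [zr dr] zt y yt yd.
  have h1 : `|f z0 - f y| < e / 2.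
    apply: fr => // j.
    rewrite (_ : z0 0 j - y 0 j = (z0 0 j - z 0 j) + - (y 0 j - z 0 j)); last by ring.
    rewrite (le_lt_trans (le_normcD _ _))// normcN (splitr (complex.Re r)) ltrD//.
    by rewrite (lt_trans (yd j)).
  have h2 : `|f z0 - f z| < e / 2.
    by apply: fr => // j; rewrite (lt_trans (zr j))// ltr_pdivrMr// ltr_pMr// ?ltr1n//;
      rewrite -(ltcR 0 (complex.Re r)) -rE.
  rewrite (_ : f y - f z = (f z0 - f z) - (f z0 - f y)); last by ring.
  by rewrite (le_lt_trans (ler_normB _ _))// (splitr e) ltrD.
move=> h; near (0 : R)^'+ => d.
exists d; first by near: d; exact: nbhs_right_gt.
move=> y z yt zt; have : torus `<=` P d by near: d; exact: h.
by move=> /(_ z zt y yt).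
Unshelve. all: by end_near. Qed.

(* Quadratic, as in Korovkin's theorem: the averages of [|y_j - z_j| ^ 2] against
   Poisson kernels are easy to bound. *)
Lemma torus_modulus n (f : 'rV[C]_n -> R) (e : R) :
  {within torus, continuous f} -> 0 < e ->
  exists2 K : R, 0 < K & forall y z : 'rV[C]_n, torus y -> torus z ->
    `|f y - f z| <= e + K * \sum_j Normc.normc (y 0 j - z 0 j) ^+ 2.
Proof.
move=> cf e0; have [d d0 fd] := torus_unif_continuous cf e0.
have [M M0 fM] := bounded_within_torus cf.
(* When some coordinate differs by at least [d], the quadratic term alone is at least [2 * M], a
   bound for the oscillation of [f]. *)
exists (2 * M / d ^+ 2) => [|y z yt zt].
  by rewrite divr_gt0 ?mulr_gt0// exprn_gt0.
have s0 : 0 <= \sum_j Normc.normc (y 0 j - z 0 j) ^+ 2.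
  by apply: sumr_ge0 => j _; exact: sqr_ge0.
have [/forallP h|] := boolP [forall j, Normc.normc (y 0 j - z 0 j) < d].
  rewrite (le_trans (ltW (fd _ _ yt zt h)))// lerDl mulr_ge0//.
  by rewrite divr_ge0 ?sqr_ge0// mulr_ge0// ltW.
rewrite negb_forall => /existsP[j]; rewrite -leNgt => dj.
rewrite (le_trans (ler_normB _ _))// (le_trans (lerD (fM _ yt) (fM _ zt)))//.
rewrite -[leLHS]add0r lerD ?(ltW e0)//.
have -> : M + M = 2 * M / d ^+ 2 * d ^+ 2 by field; rewrite gt_eqF.
rewrite ler_wpM2l//; first by rewrite divr_ge0 ?sqr_ge0// mulr_ge0// ltW.
rewrite (bigD1 j)//=.
rewrite ler_wpDr//.
  by apply: sumr_ge0 => i _; exact: sqr_ge0.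
by rewrite ler_pXn2r// ?nnegrE ?normc_ge0// ltW.
Qed.

(** Peeling off a factor, itself at most 2, doubles the error and adds [d]; the constant solves
    [c (k + 1) = 2 c k + 1]. *)
Lemma prod_near1 I (s : seq I) (a : I -> R) (d : R) :
  (forall i, 0 <= a i <= 2) -> (forall i, `|a i - 1| <= d) ->
  `|\prod_(i <- s) a i - 1| <= (2 ^+ size s - 1) * d.
Proof.
move=> a2 ad; elim: s => [|i s ih].
  by rewrite big_nil/= subrr normr0 ?subrr mul0r.
rewrite big_cons (_ : _ - 1 = a i * (\prod_(j <- s) a j - 1) + (a i - 1)); last by ring.
rewrite (le_trans (ler_normD _ _))// normrM exprS.
have /andP[ai0 ai2] := a2 i.
rewrite (_ : _ * d = 2 * ((2 ^+ size s - 1) * d) + d); last by ring.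
by rewrite lerD// ger0_norm// ler_pM.
Qed.

Lemma prod_le_pow2 n (a : 'I_n -> R) : (forall i, 0 <= a i <= 2) -> \prod_i a i <= 2 ^+ n.
Proof.
move=> a2; rewrite -[leRHS](_ : \prod_(i < n) 2 = _); last by rewrite prodr_const card_ord.
exact: ler_prod.
Qed.

(** Korovkin's argument with nonnegative weights [W k], products over the coordinates of averaged
    kernels. The error splits into the defect of mass [f y * (\prod_j S j - 1)] and the oscillation
    [\sum_k (f y - f (w k)) * W k], which the quadratic modulus bounds by [e] times the mass plus
    [K] times the second moments. One-variable masses are at most 2, whence the factor [2 ^+ n]. *)
Lemma poisson_grid n (f : 'rV[C]_n -> R) (r e K M d : R) N : (0 < N)%N -> 0 <= r < 1 ->
    0 <= e -> 0 <= K -> 0 <= d ->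
    (forall y, torus y -> `|f y| <= M) ->
    (forall y z : 'rV[C]_n, torus y -> torus z ->
      `|f y - f z| <= e + K * \sum_j Normc.normc (y 0 j - z 0 j) ^+ 2) ->
    2 * (r ^+ N / (1 - r ^+ N)) <= d -> d <= 1 ->
  let c (k : {ffun 'I_n -> 'I_N}) := N%:R^-1 ^+ n * f (\row_j uroot N (k j)) in
  let z (k : {ffun 'I_n -> 'I_N}) : 'rV[C]_n := \row_j (r%:C%C * uroot N (k j)) in
  forall y, torus y -> `|f y - \sum_k c k * poisson (z k) y| <=
    (M * d + e + K * n%:R * (4 * (1 - r ^+ 2))) * 2 ^+ n.
Proof.
move=> N0 r01 e0 K0 d0 fM fK rd d1 c z y yt; have /andP[r0 r1] := r01.
have NR0 : 0 < N%:R :> R by rewrite ltr0n.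
have NV0 : 0 <= N%:R^-1 :> R by rewrite invr_ge0 ltW.
pose a (j : 'I_n) (i : 'I_N) : R := N%:R^-1 * pker (r%:C%C * uroot N i) (y 0 j).
have a0 j i : 0 <= a j i.
  apply: mulr_ge0 => //.
  rewrite pker_ge0// normrM uroot_norm mulr1.
  by rewrite normC_real ger0_norm// (ltcR _ 1).
pose S j := \sum_i a j i.
have Sd j : `|S j - 1| <= d by rewrite (le_trans (pker_average N0 r01 (yt j))).
have S2 j : 0 <= S j <= 2.
  rewrite sumr_ge0//=; have := le_trans (ler_norm _) (le_trans (Sd j) d1).
  by rewrite lerBlDr.
pose W (k : {ffun 'I_n -> 'I_N}) : R := \prod_j a j (k j).
have W0 k : 0 <= W k by apply: prodr_ge0.
have WS : \sum_k W k = \prod_j S j by rewrite /W -bigA_distr_bigA.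
pose w (k : {ffun 'I_n -> 'I_N}) : 'rV[C]_n := \row_j uroot N (k j).
have wt k : torus (w k) by move=> j; rewrite mxE uroot_norm.
have cW k : c k * poisson (z k) y = f (w k) * W k.
  rewrite /c -/(w k) mulrAC mulrC; congr (_ * _).
  rewrite /W big_split/= prodr_const card_ord; congr (_ * _).
  by apply: eq_bigr => j _; rewrite mxE.
have sW i : \sum_k W k * Normc.normc (w k 0 i - y 0 i) ^+ 2 <= 4 * (1 - r ^+ 2) * 2 ^+ n.
  (* The square is put into the factor of index [i], so that the moment is again a product of
     one-variable sums: one is at most [4 * (1 - r ^+ 2)], the others at most 2. *)
  pose b (j : 'I_n) (l : 'I_N) : R :=
    a j l * (if j == i then Normc.normc (uroot N l - y 0 i) ^+ 2 else 1).
  have -> : \sum_k W k * Normc.normc (w k 0 i - y 0 i) ^+ 2 = \prod_j \sum_l b j l.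
    rewrite bigA_distr_bigA; apply: eq_bigr => k _ /=.
    rewrite /b big_split/= -/(W k); congr (_ * _).
    by rewrite -big_mkcond big_pred1_eq mxE.
  rewrite (bigD1 i)//= ler_pM//.
  - apply: sumr_ge0 => l _; rewrite /b eqxx mulr_ge0 ?sqr_ge0//.
  - apply: prodr_ge0 => j ji; rewrite /b (negbTE ji).
    by under eq_bigr do rewrite mulr1; have /andP[] := S2 j.
  - rewrite [leRHS](_ : _ = \sum_(l < N) N%:R^-1 * (4 * (1 - r ^+ 2))).
      apply: ler_sum => l _; rewrite /b eqxx /a -mulrA ler_wpM2l//.
      by rewrite pker_uroot_sqr ?uroot_norm.
    by rewrite sumr_const card_ord -[RHS]mulr_natl mulrA mulfV ?gt_eqF// mul1r.
  - apply: (@le_trans _ _ (\prod_(j | j != i) (2 : R))).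
      apply: ler_prod => j ji; rewrite /b (negbTE ji).
      by under eq_bigr do rewrite mulr1; exact: S2.
    rewrite prodr_const ler_eXn2l ?ltr1n//.
    by rewrite (leq_trans (max_card _))// card_ord.
under eq_bigr do rewrite cW.
have -> : f y - \sum_k f (w k) * W k =
    - (f y * (\prod_j S j - 1)) + \sum_k (f y - f (w k)) * W k.
  under [X in _ = _ + X]eq_bigr do rewrite mulrBl.
  by rewrite sumrB -mulr_sumr WS; ring.
rewrite (le_trans (ler_normD _ _))// normrN normrM.
have h1 : `|f y| * `|\prod_j S j - 1| <= M * d * 2 ^+ n.
  rewrite -mulrA ler_pM ?fM//; apply: le_trans (prod_near1 _ S2 Sd) _.
  rewrite mulrC ler_wpM2l// [size _](_ : _ = n) ?lerBlDr ?lerDl//.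
  by rewrite /index_enum -enumT size_enum_ord.
have h2 : `|\sum_k (f y - f (w k)) * W k| <= (e + K * n%:R * (4 * (1 - r ^+ 2))) * 2 ^+ n.
  rewrite (le_trans (ler_norm_sum _ _ _))//.
  apply: (@le_trans _ _ (\sum_k (e * W k +
      K * \sum_i W k * Normc.normc (w k 0 i - y 0 i) ^+ 2))).
    apply: ler_sum => k _; rewrite normrM (ger0_norm (W0 k)).
    apply: (@le_trans _ _ ((e + K * \sum_j Normc.normc (w k 0 j - y 0 j) ^+ 2) * W k)).
      by rewrite ler_wpM2r// distrC fK.
    by rewrite mulrDl -mulrA mulr_suml; under eq_bigr do rewrite mulrC.
  rewrite big_split/= -mulr_sumr WS -mulr_sumr exchange_big/= mulrDl lerD//.
    by rewrite ler_wpM2l// prod_le_pow2.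
  rewrite -!mulrA ler_wpM2l// (le_trans (ler_sum _ (fun i _ => sW i)))//.
  by rewrite sumr_const card_ord -[leLHS]mulr_natl !mulrA.
rewrite (_ : (M * d + e + _) * _ = M * d * 2 ^+ n +
  (e + K * n%:R * (4 * (1 - r ^+ 2))) * 2 ^+ n); last by ring.
exact: lerD.
Qed.

Lemma poisson_dense n (f : 'rV[C]_n -> R) (e : R) :
  {within torus, continuous f} -> 0 < e ->
  exists (I : finType) (c : I -> R) (z : I -> 'rV[C]_n),
    (forall k, polydisc (z k)) /\
    forall y, torus y -> `|f y - \sum_k c k * poisson (z k) y| <= e.
Proof.
(* [poisson_grid] has three error terms and a factor [2 ^+ n]; each term is to be at most [E]. *)
move=> cf e0; pose E := e / 3 / 2 ^+ n.
have E0 : 0 < E by rewrite !divr_gt0// exprn_gt0.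
have [K K0 fK] := torus_modulus cf E0.
have [M M0 fM] := bounded_within_torus cf.
(* With [s = 1 - r] one has [1 - r ^+ 2 <= 2 * s], so the moment term is at most [K * n * 8 * s];
   the added 1 keeps [B] positive in dimension 0. *)
pose B := K * n%:R * 8 + 1.
have B0 : 0 < B by rewrite ltr_wpDl// !mulr_ge0// ltW.
pose s := Num.min (1 / 2) (E / B).
have s0 : 0 < s by rewrite lt_min !divr_gt0.
have s12 : s <= 1 / 2 by rewrite ge_min lexx.
have sE : s * B <= E by rewrite -ler_pdivlMr// ge_min lexx orbT.
pose r := 1 - s.
have r01 : 0 <= r < 1 by rewrite /r; lra.
(* As [t <= 1 / 4], a power [r ^+ N < t] makes the bound of [pker_average] at most [4 * t], which
   serves as [d] in [poisson_grid]. Hence [r] is fixed before [N]. *)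
pose t := Num.min (1 / 4) (E / (4 * M)).
have t0 : 0 < t by rewrite lt_min !divr_gt0 ?mulr_gt0.
have t14 : t <= 1 / 4 by rewrite ge_min lexx.
have tE : 4 * t * M <= E.
  by rewrite mulrAC mulrC -ler_pdivlMr ?mulr_gt0// ge_min lexx orbT.
have [N rN] := expr_lt_eps r01 t0.
have N0 : (0 < N)%N.
  by rewrite lt0n; apply: contraTneq rN => ->; rewrite expr0 -leNgt; lra.
pose x := r ^+ N.
have x0 : 0 <= x by rewrite exprn_ge0//; have /andP[] := r01.
have xd : 2 * (x / (1 - x)) <= 4 * t.
  have x1 : 0 < 1 - x by rewrite /x; lra.
  rewrite mulrA ler_pdivrMr//; rewrite -/x in rN; nra.
have t4 : 4 * t <= 1 by lra.
have KE : K * n%:R * (4 * (1 - r ^+ 2)) <= E.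
  have -> : 1 - r ^+ 2 = s * (2 - s) by rewrite /r; ring.
  apply: le_trans sE; rewrite /B.
  have Kn : 0 <= K * n%:R by rewrite mulr_ge0// ltW.
  nra.
exists {ffun 'I_n -> 'I_N}; eexists; eexists; split; last first.
  move=> y yt.
  apply: le_trans (poisson_grid N0 r01 (ltW E0) (ltW K0) _ fM fK xd t4 yt) _.
    by rewrite mulr_ge0// ltW.
  rewrite (le_trans (ler_wpM2r _ (_ : _ <= 3 * E)))//.
  - by rewrite [M * _]mulrC; lra.
  - by rewrite le_eqVlt /E; apply/orP; left; apply/eqP; field; rewrite expf_neq0.
move=> k j; rewrite mxE normrM uroot_norm mulr1 normC_real.
have /andP[r0 r1] := r01.
by rewrite ger0_norm// (ltcR _ 1).
Qed.

End poisson_approximation.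

(** * Clark measures of finite Blaschke products *)

Section finite_blaschke.
Context {R : realType}.
Local Notation C := R[i].

(** Reflection identities are available away from the origin only. *)
Lemma poly_eq_neq0 (p q : {poly C}) : (forall w, w != 0 -> p.[w] = q.[w]) -> p = q.
Proof.
move=> pq; apply/eqP; rewrite -subr_eq0; apply/negPn/negP => pq0.
pose rs : seq C := [seq k.+1%:R | k <- iota 0 (size (p - q)%R)].
have : (size rs < size (p - q)%R)%N.
  apply: max_poly_roots => //.
    apply/allP => _ /mapP[k _ ->]; rewrite /root hornerD hornerN pq ?subrr//.
  by rewrite map_inj_uniq ?iota_uniq// => i j /eqP; rewrite eqr_nat => /eqP[].
by rewrite size_map size_iota ltnn.
Qed.

(** A parameter [b = 0] contributes 1 here and ['X] to [bpoly_num], so a denominator whose degree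
    drops keeps the full number of Blaschke factors. *)
Definition bpoly_den (bs : seq C) : {poly C} := \prod_(b <- bs) (1 - b *: 'X).
Definition bpoly_num (bs : seq C) : {poly C} := \prod_(b <- bs) ('X - (b^*%C)%:P).

Lemma bpoly_denE bs w : (bpoly_den bs).[w] = \prod_(b <- bs) (1 - b * w).
Proof.
by rewrite horner_prod; apply: eq_bigr => b _; rewrite !hornerE.
Qed.

Lemma bpoly_numE bs w : (bpoly_num bs).[w] = \prod_(b <- bs) (w - b^*%C).
Proof.
by rewrite horner_prod; apply: eq_bigr => b _; rewrite !hornerE.
Qed.

Lemma bpoly_den_neq0 bs w : all (fun b => `|b| < 1) bs -> `|w| <= 1 ->
  (bpoly_den bs).[w] != 0.
Proof.
move=> /allP b1 w1; rewrite bpoly_denE prodf_seq_neq0; apply/allP => b /b1 bb1.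
by rewrite one_subM_neq0.
Qed.

Lemma bpoly_num_reflect bs w : w != 0 ->
  (bpoly_num bs).[w] = w ^+ size bs * ((bpoly_den bs).[(w^*%C)^-1])^*%C.
Proof.
move=> w0; rewrite bpoly_denE bpoly_numE.
elim: bs => [|b bs ih]; first by rewrite !big_nil [X in _ * X]conjc1 mulr1.
rewrite !big_cons ih rmorphM/= exprS mulrACA; congr (_ * _).
rewrite rmorphB rmorphM [X in _ * (X - _)]conjc1 fmorphV [X in _ / X]conjcK.
by field.
Qed.

(** The parameters are the inverses of the roots of [p], which lie outside the closed disc, padded
    with zeros up to length [N]. *)
Lemma blaschke_factor (p q : {poly C}) (N : nat) (k : C) :
    (size p <= N.+1)%N -> (forall w, `|w| <= 1 -> p.[w] != 0) ->
    (forall w, w != 0 -> q.[w] = k * w ^+ N * (p.[(w^*%C)^-1]^*)%C) ->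
  exists (c : C) (bs : seq C), [/\ size bs = N, all (fun b => `|b| < 1) bs, c != 0,
    p = c *: bpoly_den bs & q = (k * c^*%C) *: bpoly_num bs].
Proof.
move=> sp p0 qE; have [rs pE] := closed_field_poly_normal p.
have lp0 : lead_coef p != 0.
  rewrite lead_coef_eq0; apply: contraNneq (p0 0 _) => [->|]; first by rewrite horner0.
  by rewrite normr0.
have rs1 : all (fun r : C => 1 < `|r|) rs.
  apply/allP => r rrs; rewrite real_ltNge ?num_real ?normr_real ?real1//.
  apply/negP => /p0; rewrite pE hornerZ horner_prod (big_rem r)//=.
  by rewrite hornerXsubC subrr mul0r mulr0 eqxx.
have srs : (size rs <= N)%N.
  have := sp; rewrite pE size_scale// size_prod_XsubC; exact.
pose bs := [seq r^-1 | r <- rs] ++ nseq (N - size rs) 0.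
pose c := lead_coef p * \prod_(r <- rs) - r.
have sbs : size bs = N by rewrite size_cat size_map size_nseq subnKC.
have rs0 r : r \in rs -> r != 0.
  by move=> /(allP rs1) r1; rewrite -normr_gt0 (lt_trans _ r1).
have pb : p = c *: bpoly_den bs.
  rewrite {1}pE /c -scalerA; congr (_ *: _).
  rewrite /bpoly_den /bs big_cat/= [X in _ *: (_ * X)]big1_seq ?mulr1; last first.
    by move=> b; rewrite mem_nseq => /= /andP[_ /eqP ->]; rewrite scale0r subr0.
  rewrite big_map; elim: rs rs0 {pE rs1 srs bs c sbs} => [|r rs ih] r0.
    by rewrite !big_nil scale1r.
  rewrite !big_cons ih; last by move=> x xrs; apply: r0; rewrite in_cons xrs orbT.
  have -> : 'X - r%:P = - r *: (1 - r^-1 *: 'X).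
    rewrite scalerBr scalerA mulNr mulfV ?r0 ?mem_head// scaleN1r opprK.
    by rewrite addrC scaleNr -mul_polyC mulr1.
  by rewrite -scalerAr -scalerAl scalerA mulrC.
exists c, bs; split => //.
- rewrite all_cat; apply/andP; split.
    apply/allP => _ /mapP[r rrs ->]; rewrite normfV invf_lt1 ?(allP rs1)//.
    by rewrite normr_gt0 rs0.
  by apply/allP => b; rewrite mem_nseq => /andP[_ /eqP ->]; rewrite normr0.
- rewrite mulf_neq0// prodf_seq_neq0; apply/allP => r /rs0 r0.
  by rewrite oppr_eq0.
apply: poly_eq_neq0 => w w0; rewrite qE// pb !hornerZ bpoly_num_reflect// sbs.
by rewrite rmorphM /= !mulrA [_ * c^*%C]mulrAC.
Qed.

Lemma norm_bpoly bs w : `|w| = 1 -> `|(bpoly_num bs).[w]| = `|(bpoly_den bs).[w]|.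
Proof.
move=> w1; rewrite bpoly_num_reflect ?unit_neq0// normrM normrX w1 expr1n mul1r.
by rewrite normcJ conjc_unit// invrK.
Qed.

(** Each factor is a strict contraction, by the identity [|1 - b w|^2 - |w - b^*|^2 = (1 - |b|^2) (1
    - |w|^2)]. *)
Lemma norm_bpoly_lt bs w : all (fun b => `|b| < 1) bs -> (0 < size bs)%N ->
  `|w| < 1 -> `|(bpoly_num bs).[w]| < `|(bpoly_den bs).[w]|.
Proof.
move=> b1 + w1; rewrite bpoly_denE bpoly_numE.
have lt1 (b : C) : `|b| < 1 -> `|w - b^*%C| < `|1 - b * w|.
  move=> bb1; rewrite -(@ltr_pXn2r _ 2)// ?nnegrE ?normr_ge0// !sqr_normc.
  have -> : ((1 - b * w)^*)%C = 1 - b^*%C * w^*%C.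
    by rewrite rmorphB rmorphM [X in X - _]conjc1.
  have -> : ((w - b^*%C)^*)%C = w^*%C - b by rewrite rmorphB [X in _ - X](conjcK b).
  rewrite -subr_gt0.
  have -> : (1 - b * w) * (1 - b^*%C * w^*%C) - (w - b^*%C) * (w^*%C - b) =
      (1 - b * b^*%C) * (1 - w * w^*%C) by ring.
  by rewrite mulr_gt0// subr_gt0 -sqr_normc exprn_ilt1.
elim: bs b1 => // b bs ih /= /andP[b1 bs1] _.
rewrite !big_cons !normrM.
have [->|bs0] := eqVneq bs [::].
  by rewrite !big_nil normr1 !mulr1 lt1.
apply: ltr_pM => //; first exact: lt1.
by apply: ih => //; rewrite lt0n size_eq0.
Qed.

(* [w B'(w) / B(w)], which is also [|B'(w)|], for the Blaschke product [B] with zeros [b^*]. *)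
Definition bderiv (bs : seq C) (w : C) : R := \sum_(b <- bs) pker (b^*%C) w.

Lemma bpoly_deriv bs w : all (fun b => `|b| < 1) bs -> `|w| = 1 ->
  w * ((bpoly_num bs)^`().[w] * (bpoly_den bs).[w] -
       (bpoly_num bs).[w] * (bpoly_den bs)^`().[w]) =
  (bpoly_num bs).[w] * (bpoly_den bs).[w] * (bderiv bs w)%:C%C.
Proof.
move=> + w1; elim: bs => [_|b bs ih /= /andP[b1 bs1]].
  by rewrite /bpoly_num /bpoly_den /bderiv !big_nil derivC !hornerC; ring.
rewrite /bpoly_num /bpoly_den /bderiv !big_cons -/(bpoly_num bs) -/(bpoly_den bs).
rewrite -/(bderiv bs w) rmorphD/=.
set L := 'X - _; set M := 1 - b *: 'X.
have LE : L.[w] = w - b^*%C by rewrite hornerXsubC.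
have ME : M.[w] = 1 - b * w by rewrite /M !hornerE.
have LE' : L^`().[w] = 1 by rewrite derivXsubC hornerC.
have ME' : M^`().[w] = - b.
  by rewrite derivB derivC derivZ derivX sub0r hornerN hornerZ hornerC mulr1.
clearbody L M; rewrite !derivM !(hornerM, hornerD) LE ME LE' ME' {L M LE ME LE' ME'}.
have b1' : `|b^*%C| < 1 by rewrite normcJ.
have [d1 d2] := pker_neq0 b1' w1.
rewrite pkerE// [(b^*)^*%C]conjcK in d2 *.
have := ih bs1; set A := (bpoly_den bs).[w]; set B := (bpoly_num bs).[w].
set B' := _.[w]; set A' := _.[w] => h.
have -> : w * ((1 * B + (w - b^*%C) * B') * ((1 - b * w) * A) -
    (w - b^*%C) * B * (- b * A + (1 - b * w) * A')) =
    (w - b^*%C) * (1 - b * w) * (w * (B' * A - B * A')) + w * (1 - b * b^*%C) * A * B by ring.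
rewrite h; field; by rewrite d1 d2.
Qed.

Lemma bderiv_gt0 bs w : all (fun b => `|b| < 1) bs -> (0 < size bs)%N -> `|w| = 1 ->
  0 < bderiv bs w.
Proof.
case: bs => // b bs /= /andP[b1 bs1] _ w1; rewrite /bderiv big_cons.
have b1' : `|b^*%C| < 1 by rewrite normcJ.
rewrite ltr_pwDl//.
  rewrite divr_gt0 ?subr_gt0//; last first.
    by rewrite exprn_gt0// normc_gt0; have [] := pker_neq0 b1' w1.
  by rewrite exprn_ilt1// ?normc_ge0// normc_lt1.
rewrite big_seq; apply: sumr_ge0 => x xbs.
by rewrite pker_ge0// normcJ (allP bs1).
Qed.

(** Identifies the density defining a Clark measure as the real part of a Herglotz transform. *)
Lemma Re_cayley (a v : C) : `|a| = 1 ->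
  complex.Re ((a + v) / (a - v)) = (1 - Normc.normc v ^+ 2) / Normc.normc (a - v) ^+ 2.
Proof.
move=> a1; apply: (@complexI R).
(* For [v = a] both sides are 0, as divisions by 0. *)
have [<-|av] := eqVneq a v.
  by rewrite subrr invr0 mulr0 Normc.normc0 expr0n/= invr0 mulr0.
have a0 := unit_neq0 a1.
have avJ : (a - v)^*%C != 0 by rewrite conjc_eq0 subr_eq0.
have eJ : (a - v)^*%C = a^-1 - v^*%C by rewrite rmorphB /= (conjc_unit a1).
have -> : ((1 - Normc.normc v ^+ 2) / Normc.normc (a - v) ^+ 2)%:C%C =
    (1 - v * v^*%C) / ((a - v) * (a^-1 - v^*%C)).
  by rewrite rmorphM fmorphV rmorphB /= !normc_sqr rmorph1 eJ.
have JE : ((a + v) / (a - v))^*%C = (a^-1 + v^*%C) / (a^-1 - v^*%C).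
  by rewrite rmorphM /= fmorphV /= eJ rmorphD /= (conjc_unit a1).
rewrite ReJ_add JE eJ in avJ *; field.
rewrite subr_eq0 av a0 andbT /=.
apply: contra avJ => /eqP h; apply/eqP; rewrite -[RHS](mulr0 a^-1) -h; field.
exact: a0.
Qed.

(** Includes points [w] of the circle other than [g], where the kernel vanishes; the constant of the
    partial fraction expansion is computed at such a point. *)
Lemma Re_pole (w g : C) : `|g| = 1 -> w != g ->
  complex.Re (2 * g / (g - w)) = 1 + pker w g.
Proof.
move=> g1 wg; have g0 := unit_neq0 g1.
have := Re_cayley w g1; rewrite -/(pker w g) => <-.
have gw : g - w != 0 by rewrite subr_eq0 eq_sym.
have -> : 2 * g / (g - w) = 1 + (g + w) / (g - w) by field.
by rewrite raddfD.
Qed.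

Lemma uroot_inj N : {in gtn N &, injective (@uroot R N)}.
Proof.
suff h i j : (i < j < N)%N -> uroot N i <> uroot N j :> C.
  move=> i j iN jN ij; have [lt|lt|//] := ltngtP i j.
    by have := h i j; rewrite lt => /(_ jN).
  by have := h j i; rewrite lt => /(_ iN) /nesym.
move=> /andP[ij jN] e.
have jE : uroot N j = uroot N i * uroot N (j - i) :> C.
  by rewrite -cisD -mulrDr -mulrDl -natrD subnKC// ltnW.
have i0 : uroot N i != 0 :> C by rewrite unit_neq0// uroot_norm.
have /eqP : uroot N (j - i) = 1 :> C by apply: (mulfI i0); rewrite -jE mulr1.
have p0 : 0 < 2 * pi :> R by rewrite mulr_gt0// pi_gt0.
have N0 : (0 < N)%N by apply: leq_trans jN.
apply/negP/cis_neq1; rewrite mulr_gt0//=; last by rewrite divr_gt0// ltr0n ?subn_gt0.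
rewrite gtr_pMr// ltr_pdivrMr ?ltr0n// mul1r ltr_nat.
by rewrite (leq_ltn_trans (leq_subr _ _)).
Qed.

(* The Herglotz transform (a + q/p) / (a - q/p) is expanded in partial fractions,
   and the constant term is identified on the unit circle, where real parts vanish. *)
Lemma clark_blaschke (p q : {poly C}) (c c' a : C) (bs : seq C) (N : nat)
    (g : 'I_N -> C) (w : C) : (0 < N)%N -> size bs = N ->
    all (fun b => `|b| < 1) bs -> c != 0 -> `|c'| = `|c| ->
    p = c *: bpoly_den bs -> q = c' *: bpoly_num bs ->
    `|a| = 1 -> (forall j, `|g j| = 1) -> injective g ->
    (forall j, q.[g j] = a * p.[g j]) -> `|w| < 1 ->
  (1 - Normc.normc (q.[w] / p.[w]) ^+ 2) / Normc.normc (a - q.[w] / p.[w]) ^+ 2 =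
  \sum_j pker w (g j) / bderiv bs (g j).
Proof.
move=> N0 sbs b1 c0 cc' pE qE a1 g1 gI gq w1.
have bs0 : (0 < size bs)%N by rewrite sbs.
have p0 v : `|v| <= 1 -> p.[v] != 0.
  by move=> v1; rewrite pE hornerZ mulf_neq0// bpoly_den_neq0.
have lt_qp v : `|v| < 1 -> `|q.[v]| < `|p.[v]|.
  move=> v1; rewrite pE qE !hornerZ !normrM cc' ltr_pM2l ?normr_gt0//.
  exact: norm_bpoly_lt.
have eq_qp v : `|v| = 1 -> `|q.[v]| = `|p.[v]|.
  by move=> v1; rewrite pE qE !hornerZ !normrM cc' norm_bpoly.
pose mu j : R := bderiv bs (g j).
have mu0 j : 0 < mu j by exact: bderiv_gt0.
have dq j : g j * (q^`().[g j] * p.[g j] - q.[g j] * p^`().[g j]) =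
    q.[g j] * p.[g j] * (mu j)%:C%C.
  have := bpoly_deriv b1 (g1 j); rewrite pE qE !derivZ !hornerZ => h.
  transitivity (c * c' * (g j * ((bpoly_num bs)^`().[g j] * (bpoly_den bs).[g j] -
    (bpoly_num bs).[g j] * (bpoly_den bs)^`().[g j]))); first by ring.
  by rewrite h; ring.
(* [T / D] is the Herglotz transform; the [g j] are zeros of [D]. *)
pose D : {poly C} := a *: p - q; pose T : {poly C} := a *: p + q.
have DE v : D.[v] = a * p.[v] - q.[v] by rewrite hornerD hornerN hornerZ.
have TE v : T.[v] = a * p.[v] + q.[v] by rewrite hornerD hornerZ.
have D0 v : `|v| < 1 -> D.[v] != 0.
  move=> v1; rewrite DE subr_eq0; apply: contraTneq (lt_qp v v1) => <-.
  by rewrite normrM a1 mul1r ltxx.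
have size_den : (size (bpoly_den bs) <= N.+1)%N.
  rewrite -sbs; elim: (bs) => [|b s ih]; first by rewrite /bpoly_den big_nil size_poly1.
  rewrite /bpoly_den big_cons (leq_trans (size_polyMleq _ _))// -/(bpoly_den s).
  rewrite -subn1 leq_subLR add1n /= (leq_trans (leq_add _ ih) (_ : 2 + (size s).+1 <= _)%N)//.
  rewrite (leq_trans (size_polyD _ _))// geq_max size_poly1 /= size_polyN.
  by rewrite (leq_trans (size_scale_leq _ _))// size_polyX.
have size_num : size (bpoly_num bs) = N.+1 by rewrite size_prod_XsubC sbs.
have sp : (size p <= N.+1)%N by rewrite pE (leq_trans (size_scale_leq _ _)).
have sq : (size q <= N.+1)%N by rewrite qE (leq_trans (size_scale_leq _ _))// size_num.
have sD : (size D <= N.+1)%N.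
  rewrite (leq_trans (size_polyD _ _))// geq_max size_polyN sq.
  by rewrite (leq_trans (size_scale_leq _ _)).
have sT : (size T <= N.+1)%N.
  rewrite (leq_trans (size_polyD _ _))// geq_max sq.
  by rewrite (leq_trans (size_scale_leq _ _)).
pose Pi : {poly C} := \prod_j ('X - (g j)%:P).
pose Pj j : {poly C} := \prod_(i | i != j) ('X - (g i)%:P).
have PiE : Pi = \prod_(x <- [seq g j | j <- index_enum 'I_N]) ('X - x%:P).
  by rewrite big_map.
have size_Pi : size Pi = N.+1.
  by rewrite PiE size_prod_XsubC size_map /index_enum -enumT size_enum_ord.
(* [N] distinct roots determine a polynomial of degree at most [N] up to a scalar. This applies to
   [D], and to [T] once its values at the [g j] are cancelled. *)
have Pi_dvd (E : {poly C}) : (size E <= N.+1)%N -> (forall j, E.[g j] = 0) ->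
    exists k, E = k *: Pi.
  move=> sE E0; have : Pi %| E.
    rewrite PiE; apply: uniq_roots_dvdp.
      by apply/allP => _ /mapP[j _ ->]; rewrite /root E0.
    by rewrite uniq_rootsE map_inj_uniq ?index_enum_uniq.
  move=> /dvdpP[e ee]; have [e0|e0] := eqVneq e 0.
    by exists 0; rewrite ee e0 mul0r scale0r.
  have mPi : Pi \is monic by rewrite PiE monic_prod_XsubC.
  have : (size e <= 1)%N.
    by move: sE; rewrite ee size_Mmonic// size_Pi addnS /= -add1n leq_add2r.
  by move=> /size1_polyC e1; exists e`_0; rewrite ee {1}e1 mul_polyC.
have PiD j : Pi = ('X - (g j)%:P) * Pj j by rewrite /Pi (bigD1 j).
have [d dE] : exists d, D = d *: Pi.
  by apply: Pi_dvd => // j; rewrite DE gq subrr.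
have d0 : d != 0.
  apply: contraNneq (D0 0 _) => [d0|]; last by rewrite normr0.
  by rewrite dE d0 scale0r horner0.
have Dg j : D^`().[g j] = d * (Pj j).[g j].
  rewrite dE derivZ hornerZ (PiD j) derivM hornerD !hornerM derivXsubC hornerC.
  by rewrite hornerXsubC subrr mul0r addr0 mul1r.
have Pji j i : i != j -> (Pj i).[g j] = 0.
  move=> ij; rewrite /Pj horner_prod (bigD1 j) 1?eq_sym//=.
  by rewrite hornerXsubC subrr mul0r.
(* Minus the residue of [T / D] at [g j]: there [T = 2 a p], and [dq] gives
   [D' = - a p (mu j) / g j]. *)
pose s j : C := 2 * g j / (mu j)%:C%C.
have muC j : (mu j)%:C%C != 0 :> C by rewrite -(rmorph0 (real_complex R)) (inj_eq (@complexI R)) gt_eqF.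
have [k kE] : exists k, T + \sum_j (s j * d) *: Pj j = k *: Pi.
  apply: Pi_dvd => [|j].
    rewrite (leq_trans (size_polyD _ _))// geq_max sT /=.
    apply: (leq_trans (size_sum _ _ _)); apply/bigmax_leqP => j _.
    rewrite (leq_trans (size_scale_leq _ _))//.
    have : (size (Pj j) <= size Pi)%N.
      rewrite (PiD j) dvdp_leq ?dvdp_mull// -(PiD j) -size_poly_eq0 size_Pi//.
    by rewrite size_Pi.
  rewrite hornerD horner_sum (bigD1 j)//= big1 ?addr0; last first.
    by move=> i ij; rewrite hornerZ Pji ?mulr0.
  rewrite hornerZ -mulrA -Dg TE gq.
  have pg0 : p.[g j] != 0 by rewrite p0 ?g1.
  have := dq j; rewrite gq => h.
  have h2 : g j * (q^`().[g j] - a * p^`().[g j]) = a * p.[g j] * (mu j)%:C%C.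
    by apply: (mulIf pg0); rewrite -[RHS]mulrAC -h; ring.
  rewrite derivB derivZ hornerD hornerN hornerZ /s.
  rewrite -(opprB q^`().[g j]) mulrN mulrAC -[2 * _ * _]mulrA h2; field.
  exact: muC.
have TD v : D.[v] != 0 -> T.[v] / D.[v] = k / d + \sum_j s j / (g j - v).
  move=> Dv; have := Dv; rewrite {1}dE hornerZ mulf_eq0 negb_or d0 /= => Pv.
  have -> : T.[v] = k * Pi.[v] - \sum_j s j * d * (Pj j).[v].
    apply/eqP; rewrite -subr_eq opprK eq_sym; have := congr1 (horner^~ v) kE.
    rewrite hornerD horner_sum hornerZ => <-; apply/eqP; congr (_ + _).
    by apply: eq_bigr => j _; rewrite hornerZ.
  rewrite dE hornerZ mulrBl; congr (_ + _); first by field; rewrite d0.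
  rewrite mulr_suml -sumrN; apply: eq_bigr => j _.
  have := Pv; rewrite (PiD j) hornerM hornerXsubC mulf_eq0 negb_or subr_eq0 => /andP[vg Pjv].
  by field; rewrite Pjv d0 !subr_eq0 vg eq_sym vg.
have ReTD v : D.[v] != 0 -> complex.Re (T.[v] / D.[v]) =
    complex.Re (k / d) + \sum_j (1 + pker v (g j)) / mu j.
  move=> Dv; rewrite TD// raddfD /= Re_sum; congr (_ + _); apply: eq_bigr => j _.
  have vg : v != g j.
    by apply: contraNneq Dv => ->; rewrite DE gq subrr.
  rewrite -Re_pole// [in RHS]mulrC -Re_realM fmorphV /s; congr complex.Re.
  by rewrite [RHS]mulrA [_^-1 * _]mulrC.
have Tcayley v : p.[v] != 0 -> T.[v] / D.[v] = (a + q.[v] / p.[v]) / (a - q.[v] / p.[v]).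
  move=> pv; rewrite TE DE.
  have -> : a * p.[v] + q.[v] = (a + q.[v] / p.[v]) * p.[v] by field.
  have -> : a * p.[v] - q.[v] = (a - q.[v] / p.[v]) * p.[v] by field.
  by rewrite -mulf_div divff// mulr1.
(* [D] has at most [N] roots, so one of the [N.+1] roots of unity is not among them. *)
have [v0 v01 Dv0] : exists2 v : C, `|v| = 1 & D.[v] != 0.
  apply: contrapT => nv; pose rs : seq C := [seq uroot N.+1 i | i <- iota 0 N.+1].
  have D0' : D != 0.
    by apply: contraNneq (D0 0 _) => [->|]; rewrite ?horner0 ?normr0.
  have : (size rs < size D)%N.
    apply: max_poly_roots => //.
      apply/allP => _ /mapP[i _ ->]; apply/negPn/negP => ri.
      by apply: nv; exists (uroot N.+1 i) => //; exact: uroot_norm.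
    rewrite map_inj_in_uniq ?iota_uniq// => i j; rewrite !mem_iota /= !add0n => iN jN.
    exact: uroot_inj.
  by rewrite size_map size_iota ltnNge sD.
(* At [v0] the quotient [q / p] is unimodular, so the real part of the transform vanishes, and so do
   all the kernels. *)
have Rek : complex.Re (k / d) = - \sum_j (mu j)^-1.
  have := ReTD v0 Dv0; rewrite Tcayley ?p0 ?v01// Re_cayley//.
  have -> : Normc.normc (q.[v0] / p.[v0]) = 1.
    apply: normc_eq1; rewrite normrM normfV eq_qp// divff// normr_eq0.
    by rewrite p0// v01.
  rewrite expr1n subrr mul0r => /esym/eqP; rewrite addr_eq0 => /eqP ->.
  congr (- _); apply: eq_bigr => j _.
  by rewrite /pker (normc_eq1 v01) expr1n subrr mul0r addr0 mul1r.
rewrite -Re_cayley// -Tcayley ?p0 ?(ltW w1)// ReTD ?D0// Rek addrC -sumrB.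
by apply: eq_bigr => j _; rewrite /mu; ring.
Qed.

End finite_blaschke.

(** * Slices of rational inner functions *)

Section monomial_sums.
Context {R : realType} (d : nat).
Local Notation C := R[i].
Variables (I : eqType) (s : seq I).
Implicit Types (a : I -> C) (e : I -> 'I_d -> nat).

(** A common form for [p], its reflection and their partial derivatives: sums over the support of
    [p] with varying coefficients and exponents. *)
Definition msum a e (z : 'rV[C]_d) : C :=
  \sum_(m <- s) a m * \prod_j z 0 j ^+ e m j.

Lemma cvg_sum_seq (K : numFieldType) (V : normedModType K) (T : Type) (F : set_system T)
    (FF : Filter F) J (r : seq J) (f : J -> T -> V) (l : J -> V) :
  (forall i, f i x @[x --> F] --> l i) ->
  (\sum_(i <- r) f i x) @[x --> F] --> \sum_(i <- r) l i.
Proof.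
move=> fl; elim: r => [|i r ih].
  rewrite big_nil; under [X in X @ _]eq_fun do rewrite big_nil.
  exact: cvg_cst.
rewrite big_cons; under [X in X @ _]eq_fun do rewrite big_cons.
exact: cvgD.
Qed.

Lemma cvg_expr_seq (K : numFieldType) (T : Type) (F : set_system T) (FF : Filter F)
    (f : T -> K) (l : K) k : f x @[x --> F] --> l -> (f x ^+ k) @[x --> F] --> l ^+ k.
Proof.
move=> fl; elim: k => [|k ih]; first exact: cvg_cst.
by rewrite exprS; under [X in X @ _]eq_fun do rewrite exprS; exact: cvgM.
Qed.

Lemma continuous_msum a e : continuous (msum a e).
Proof.
move=> z; have FF := @nbhs_filter 'rV[C]_d z.
apply: (@cvg_sum_seq _ C) => m; apply: (@cvgM _ _ _ FF); first exact: cvg_cst.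
apply: (cvg_prod_seq FF) => j; apply: (cvg_expr_seq FF).
exact: coord_continuous.
Qed.

Lemma continuous_hornerC (q : {poly C}) : continuous (horner q : C -> C).
Proof.
move=> z; have FF := @nbhs_filter C z.
rewrite (_ : horner q = fun x => \sum_(i < size q) q`_i * x ^+ i); last first.
  by apply/funext => x; rewrite horner_coef.
apply: (@cvg_sum_seq _ C) => i; apply: (@cvgM _ _ _ FF); first exact: cvg_cst.
by apply: (cvg_expr_seq FF); exact: cvg_id.
Qed.

Definition mslice a e (i : 'I_d) (z : 'rV[C]_d) : {poly C} :=
  \sum_(m <- s) (a m * \prod_(j | j != i) z 0 j ^+ e m j) *: 'X^(e m i).

Lemma prod_upd (z : 'rV[C]_d) i w (k : 'I_d -> nat) :
  \prod_j upd z i w 0 j ^+ k j = (\prod_(j | j != i) z 0 j ^+ k j) * w ^+ k i.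
Proof.
rewrite (bigD1 i)//= mxE eqxx mulrC; congr (_ * _).
by apply: eq_bigr => j ji; rewrite mxE (negbTE ji).
Qed.

Lemma msliceE a e i z w : (mslice a e i z).[w] = msum a e (upd z i w).
Proof.
rewrite /mslice horner_sum; apply: eq_bigr => m _.
by rewrite hornerZ hornerXn prod_upd mulrA.
Qed.

Definition mderiv_coef a e (i : 'I_d) m : C := a m * (e m i)%:R.
Definition mderiv_exp e (i : 'I_d) m (j : 'I_d) : nat := if j == i then (e m i).-1 else e m j.

Lemma mslice_deriv a e i z w : (mslice a e i z)^`().[w] =
  msum (mderiv_coef a e i) (mderiv_exp e i) (upd z i w).
Proof.
rewrite /mslice raddf_sum/= horner_sum; apply: eq_bigr => m _.
rewrite derivZ derivXn hornerZ hornerMn hornerXn prod_upd /mderiv_coef /mderiv_exp eqxx.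
under [in RHS]eq_bigr => j /negbTE ji do rewrite ji.
by rewrite -mulr_natl; ring.
Qed.

Lemma size_mslice a e i z N : (forall m, m \in s -> (e m i <= N)%N) ->
  (size (mslice a e i z) <= N.+1)%N.
Proof.
move=> eN; apply: (leq_trans (size_sum _ _ _)); apply/bigmax_leqP_seq => m ms _.
by rewrite (leq_trans (size_scale_leq _ _))// size_polyXn ltnS eN.
Qed.

End monomial_sums.

Section rational_functions.
Context {R : realType} (d : nat).
Local Notation C := R[i].
Variables (n : mpoly.multinom d) (p : mpoly.mpoly d C).

Local Notation supp := (mpoly.msupp p).
Local Notation cp := (fun m : mpoly.multinom d => mpoly.mcoeff m p).
Local Notation ep := (fun (m : mpoly.multinom d) (j : 'I_d) => m j : nat).
Local Notation cq := (fun m : mpoly.multinom d => (mpoly.mcoeff m p)^*%C).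
Local Notation rq := (fun (m : mpoly.multinom d) (j : 'I_d) => (n j - m j)%N).

Lemma peval_msum z : peval p z = msum supp cp ep z.
Proof. by rewrite /peval mpoly.mevalE. Qed.

Lemma reflect_msum z : peval (Defs.reflect n p) z = msum supp cq rq z.
Proof.
rewrite /peval /Defs.reflect raddf_sum/=; apply: eq_bigr => m _.
rewrite mpoly.mevalZ mpoly.mevalX; congr (_ * _).
by apply: eq_bigr => j _; rewrite mpoly.mnmBE.
Qed.

Definition pslice := mslice supp cp ep.
Definition rslice := mslice supp cq rq.

Lemma psliceE i z w : (pslice i z).[w] = peval p (upd z i w).
Proof. by rewrite msliceE peval_msum. Qed.

Lemma rsliceE i z w : (rslice i z).[w] = peval (Defs.reflect n p) (upd z i w).
Proof. by rewrite msliceE reflect_msum. Qed.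

Lemma continuous_peval : continuous (peval p).
Proof.
by rewrite (_ : peval p = msum supp cp ep); [exact: continuous_msum|exact/funext/peval_msum].
Qed.

Lemma continuous_reflect : continuous (peval (Defs.reflect n p)).
Proof.
rewrite (_ : peval _ = msum supp cq rq); first exact: continuous_msum.
exact/funext/reflect_msum.
Qed.

Lemma upd_id (z : 'rV[C]_d) i : upd z i (z 0 i) = z.
Proof. by apply/rowP => j; rewrite mxE; case: eqP => [->|]. Qed.

Lemma closed_polydisc_upd (z : 'rV[C]_d) i w :
  closed_polydisc z -> `|w| <= 1 -> closed_polydisc (upd z i w).
Proof. by move=> zt w1 j; rewrite mxE; case: ifP. Qed.

Hypothesis pn : forall j, degree_in p j = n j.
Hypothesis p0 : no_singularities p.

Lemma degree_in_supp m i : m \in supp -> (m i <= n i)%N.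
Proof. by move=> ms; rewrite -pn /degree_in (big_rem m)//= leq_maxl. Qed.

Lemma pslice_neq0 i z w : closed_polydisc z -> `|w| <= 1 -> (pslice i z).[w] != 0.
Proof. by move=> zd w1; rewrite psliceE p0//; exact: closed_polydisc_upd. Qed.

(** The fixed coordinates satisfy [1 / z^* = z], so the reflection in all variables restricts to the
    one-variable reflection at degree [n i], up to the unimodular factor [k]. *)
Lemma slice_blaschke i z : torus z -> exists (c c' : C) (bs : seq C),
  [/\ size bs = n i, all (fun b => `|b| < 1) bs, c != 0 & `|c'| = `|c|] /\
  [/\ pslice i z = c *: bpoly_den bs & rslice i z = c' *: bpoly_num bs].
Proof.
move=> zt; pose k := \prod_(j | j != i) z 0 j ^+ n j.
have k1 : `|k| = 1.
  by rewrite normr_prod big1// => j _; rewrite normrX zt expr1n.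
have [|w w1|w w0|c [bs [sbs b1 c0 pE qE]]] :=
    @blaschke_factor R (pslice i z) (rslice i z) (n i) k.
- by apply: size_mslice => m; exact: degree_in_supp.
- by apply: pslice_neq0 => //; exact: torus_closed_polydisc.
- rewrite rsliceE reflectE; last 2 first.
  + by move=> j; rewrite pn.
  + by move=> j; rewrite mxE; case: ifP => // _; exact: unit_neq0.
  rewrite prod_upd psliceE; congr (_ * (peval p _)^*%C).
  apply/rowP => j; rewrite !mxE; case: ifP => // _.
  by rewrite (conjc_unit (zt j)) invrK.
exists c, (k * c^*%C), bs; split; split => //.
by rewrite normrM k1 mul1r normcJ.
Qed.

(* The quotient rule for p~/p. Unlike ['D_(delta_mx 0 i)], it is visibly
   continuous in all the variables. *)
Definition rif_deriv i z : C :=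
  ((rslice i z)^`().[z 0 i] * peval p z -
   peval (Defs.reflect n p) z * (pslice i z)^`().[z 0 i]) / peval p z ^+ 2.

Lemma continuous_rif_deriv i z : peval p z != 0 -> {for z, continuous (rif_deriv i)}.
Proof.
move=> pz; have FF := @nbhs_filter 'rV[C]_d z.
have cr : {for z, continuous (fun z => (rslice i z)^`().[z 0 i])}.
  rewrite (_ : (fun z => _) = msum supp (mderiv_coef cq rq i) (mderiv_exp rq i)).
    exact: continuous_msum.
  by apply/funext => y; rewrite mslice_deriv upd_id.
have cpz : {for z, continuous (fun z => (pslice i z)^`().[z 0 i])}.
  rewrite (_ : (fun z => _) = msum supp (mderiv_coef cp ep i) (mderiv_exp ep i)).
    exact: continuous_msum.
  by apply/funext => y; rewrite mslice_deriv upd_id.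
have c1 := @continuous_peval z; have c2 := @continuous_reflect z.
have h1 := @cvgM C _ (nbhs z) FF _ _ _ _ cr c1.
have h2 := @cvgM C _ (nbhs z) FF _ _ _ _ c2 cpz.
have h3 := @cvgB C C _ (nbhs z) FF _ _ _ _ h1 h2.
have h4 := @cvg_expr_seq C _ (nbhs z) FF _ _ 2 c1.
have pz2 : peval p z ^+ 2 != 0 by rewrite expf_neq0.
have h5 := @cvgV C _ (nbhs z) FF _ _ pz2 h4.
exact: (@cvgM C _ (nbhs z) FF _ _ _ _ h3 h5).
Qed.

(** The polynomial [P(w) Q - Q(w) P] vanishes at [w], hence equals [S] times ['X - w]. The
    difference quotient becomes [S(w + h) / (P(w + h) P(w))], which has an evident limit. *)
Lemma rif_derivE i z : peval p z != 0 ->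
  'D_(delta_mx 0 i) (rational_function n p) z = rif_deriv i z.
Proof.
move=> pz; rewrite /derive; apply: cvg_lim; first exact: (@norm_hausdorff _ C).
set P := pslice i z; set Q := rslice i z; set w := z 0 i.
have Pw : P.[w] = peval p z by rewrite psliceE upd_id.
have Qw : Q.[w] = peval (Defs.reflect n p) z by rewrite rsliceE upd_id.
have /factor_theorem[S SE] : root (P.[w] *: Q - Q.[w] *: P) w.
  by rewrite /root hornerD hornerN !hornerZ mulrC subrr.
have Sw : S.[w] = P.[w] * Q^`().[w] - Q.[w] * P^`().[w].
  have := congr1 (fun r => r^`().[w]) SE.
  rewrite derivM derivB !derivZ derivXsubC !hornerD hornerN !hornerZ !hornerM.
  by rewrite hornerXsubC subrr mulr0 add0r hornerC mulr1 => ->.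
have updE (h : C) : h *: delta_mx 0 i + z = upd z i (w + h).
  apply/rowP => j; rewrite !mxE eqxx /= eq_sym; case: eqP => [<-|_].
    by rewrite mulr1 addrC.
  by rewrite mulr0 add0r.
have cP (q : {poly C}) : q.[w + h] @[h --> 0^'] --> q.[w].
  have F0 := @nbhs_filter C 0.
  have c0 : q.[w + h] @[h --> (0 : C)] --> q.[w + 0].
    apply: (@continuous_comp _ _ _ (fun h : C => w + h) (horner q)).
      apply: (@cvgD C C _ (nbhs 0) F0); [exact: (@cvg_cst _ _ _ _ F0)|exact: cvg_id].
    exact: continuous_hornerC.
  rewrite addr0 in c0.
  exact: (@cvg_within_filter C C (fun h => q.[w + h]) (nbhs (0 : C)) F0 (nbhs q.[w]) _ c0).
have -> : rif_deriv i z = S.[w] / (P.[w] * P.[w]).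
  rewrite /rif_deriv Sw -Pw -Qw -/w -/P -/Q expr2; congr (_ / _).
  by rewrite mulrC.
apply: (@cvg_trans _ (S.[w + h] / (P.[w + h] * P.[w]) @[h --> 0^'])); last first.
  apply: cvgM; first exact: cP.
  apply: cvgV; first by rewrite Pw mulf_neq0.
  by apply: cvgM; [exact: cP|exact: cvg_cst].
apply: near_eq_cvg.
have P0 : \forall h \near (0 : C)^', P.[w + h] != 0.
  have Pw0 : P.[w] != 0 by rewrite Pw.
  exact: (@cvgr_neq0 C C C (0 : C)^' _ (fun h => P.[w + h]) P.[w] (cP P) Pw0).
near=> h; have h0 : h != 0 by near: h; exact: nbhs_dnbhs_neq.
have Ph : P.[w + h] != 0 by near: h.
rewrite /= /rational_function updE -psliceE -rsliceE -/P -/Q -Qw -Pw.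
have := congr1 (horner^~ (w + h)) SE.
rewrite hornerD hornerN !hornerZ hornerM hornerXsubC [w + h - w]addrC addKr => e.
have -> : Q.[w + h] / P.[w + h] - Q.[w] / P.[w] =
    (P.[w] * Q.[w + h] - Q.[w] * P.[w + h]) / (P.[w + h] * P.[w]).
  by field; rewrite Ph Pw pz.
rewrite e /GRing.scale/=; field.
by rewrite Ph h0 Pw pz.
Unshelve. all: by end_near. Qed.

End rational_functions.

(** * The maximum principle on the closed polydisc *)

Section maximum_principle.
Context {R : realType}.
Local Notation C := R[i].
Local Notation U := (uniform_prob (@ltr01 R)).
Local Notation circ x := (cis (2 * pi * x : R)).

Lemma Rintegral_pker (w : C) : `|w| < 1 -> \int[U]_x pker w (circ x) = 1.
Proof.
move=> w1; have := @Rintegral_pker_horner R 1 w w1.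
rewrite hornerC /= => h; rewrite -[RHS]h.
by apply: eq_Rintegral => x _; rewrite hornerC mulr1.
Qed.

(** The constant [c] rotates [F(w)] to its modulus; the Poisson formula then bounds it by [r], since
    the kernel is nonnegative with mean 1. *)
Lemma disc_algebra_max (F : C -> C) (r : R) : disc_algebra F ->
  (forall w, `|w| = 1 -> Normc.normc (F w) <= r) ->
  forall w, `|w| <= 1 -> Normc.normc (F w) <= r.
Proof.
move=> dF Fr w; rewrite le_eqVlt => /predU1P[/Fr//|w1].
have r0 : 0 <= r by apply: le_trans (Fr 1 _); rewrite ?normc_ge0 ?normr1.
have [->|Fw0] := eqVneq (F w) 0; first by rewrite Normc.normc0.
pose c := (F w)^*%C / `|F w|.
have c1 : Normc.normc c = 1.
  by apply: normc_eq1; rewrite normrM normcJ normfV normr_id divff// normr_eq0.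
have dcF : disc_algebra (fun v => c * F v).
  apply: (@disc_algebra_ext _ (fun v => c%:P.[v] * F v)).
    by move=> v _; rewrite hornerC.
  exact: disc_algebraM (disc_algebra_horner _) dF.
have cF : c * F w = (Normc.normc (F w))%:C%C.
  rewrite /c mulrAC [_^*%C * _]mulrC -sqr_normc expr2 mulfK// normr_eq0//.
have := poisson_disc_algebra dcF w1; rewrite cF /= => <-.
have ip : U.-integrable setT (EFin \o (fun x => pker w (circ x))).
  have [M M0 PM] := pker_bounded w1.
  apply: (bounded_integrable measurableT uniform01_setT (M := M)).
    exact: measurable_pker_circ.
  by move=> x _; apply: PM; exact: normc_cis.
have -> : r = \int[U]_x (r * pker w (circ x)).
  by rewrite RintegralZl// Rintegral_pker// mulr1.
apply: le_Rintegral => //.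
- have [M M0 PM] := pker_bounded w1.
  have [N N0 GN] := disc_algebra_bounded_Re dcF.
  apply: (bounded_integrable measurableT uniform01_setT (M := M * N)).
    apply: measurable_funM; first exact: measurable_pker_circ.
    exact: (measurable_Re_disc_algebra dcF).
  by move=> x _; rewrite normrM ler_pM ?PM ?GN// normc_cis.
- have := integrableZl measurableT r ip.
  by congr (_.-integrable _ _).
move=> x _; rewrite mulrC ler_wpM2r//; first exact: pker_ge0.
rewrite (le_trans (ler_norm _))// (le_trans (normr_Re _))//.
by rewrite Normc.normcM c1 mul1r Fr// normc_cis.
Qed.

Lemma polydisc_max n (F : 'rV[C]_n -> C) (r : R) : separately_disc_algebra F ->
  (forall z, torus z -> Normc.normc (F z) <= r) ->
  forall z, closed_polydisc z -> Normc.normc (F z) <= r.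
Proof.
move=> dF Fr z zd.
(* Coordinates leave the circle one at a time: those of index at least [k] are still on it. *)
suff h k : forall z, closed_polydisc z -> (forall j : 'I_n, (k <= j)%N -> `|z 0 j| = 1) ->
    Normc.normc (F z) <= r.
  by apply: (h n) => // j; rewrite leqNgt ltn_ord.
elim: k {z zd} => [|k ih] z zd zk; first by apply: Fr => j; exact: zk.
have [kn|kn] := ltnP k n; last first.
  by apply: ih => // j kj; have := leq_trans kn kj; rewrite leqNgt ltn_ord.
pose i := Ordinal kn.
rewrite -(upd_id z i); apply: (disc_algebra_max (dF z i zd)); last exact: zd.
move=> w w1; apply: ih; first by apply: closed_polydisc_upd; rewrite ?w1.
move=> j kj; rewrite mxE; case: eqP => // ji; apply: zk.
by rewrite ltn_neqAle kj andbT; apply: contra_notN ji => /eqP kj'; exact/val_inj.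
Qed.

End maximum_principle.

(** * Adjoining the last coordinate *)

Section snoc.
Context {R : realType} (d : nat).
Local Notation C := R[i].
Implicit Types (z : 'rV[C]_d) (w : C).

Lemma snoc_last z w : snoc z w 0 ord_max = w.
Proof. by rewrite mxE unlift_none. Qed.

Lemma snoc_lift z w j : snoc z w 0 (lift ord_max j) = z 0 j.
Proof. by rewrite mxE liftK. Qed.

Lemma forall_snoc (P : C -> Prop) z w :
  (forall j, P (z 0 j)) -> P w -> forall j, P (snoc z w 0 j).
Proof.
by move=> Pz Pw j; case: (unliftP ord_max j) => [k|] ->; rewrite ?snoc_lift ?snoc_last.
Qed.

Lemma torus_snoc z w : torus z -> `|w| = 1 -> torus (snoc z w).
Proof. by move=> zt w1; apply: (forall_snoc (P := fun v => `|v| = 1)). Qed.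

Lemma closed_polydisc_snoc z w : closed_polydisc z -> `|w| <= 1 -> closed_polydisc (snoc z w).
Proof. by move=> zt w1; apply: (forall_snoc (P := fun v => `|v| <= 1)). Qed.

Lemma polydisc_snoc z w : polydisc z -> `|w| < 1 -> polydisc (snoc z w).
Proof. by move=> zt w1; apply: (forall_snoc (P := fun v => `|v| < 1)). Qed.

Lemma snoc_eta (y : 'rV[C]_d.+1) : y = snoc (\row_j y 0 (lift ord_max j)) (y 0 ord_max).
Proof.
apply/rowP => j; case: (unliftP ord_max j) => [k|] ->.
  by rewrite snoc_lift mxE.
by rewrite snoc_last.
Qed.

Lemma upd_snoc_last z w v : upd (snoc z w) ord_max v = snoc z v.
Proof.
apply/rowP => j; case: (unliftP ord_max j) => [k|] ->.
  by rewrite snoc_lift mxE eq_sym (negbTE (neq_lift _ _)) snoc_lift.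
by rewrite snoc_last mxE eqxx.
Qed.

Lemma snoc_upd z w i v : snoc (upd z i v) w = upd (snoc z w) (lift ord_max i) v.
Proof.
apply/rowP => j; case: (unliftP ord_max j) => [k|] ->.
  by rewrite snoc_lift !mxE (inj_eq (@lift_inj _ _)) liftK.
by rewrite snoc_last !mxE (negbTE (neq_lift _ _)) unlift_none.
Qed.

Lemma continuous_snoc w : continuous (fun z => snoc z w).
Proof.
move=> z; apply: continuous_row => j; case: (unliftP ord_max j) => [k|] ->.
  under [X in {for _, continuous X}]eq_fun do rewrite snoc_lift.
  exact: coord_continuous.
under [X in {for _, continuous X}]eq_fun do rewrite snoc_last.
exact: cst_continuous.
Qed.

Lemma poisson_snoc (w v : C) z (y : 'rV[C]_d) :
  poisson (snoc z w) (snoc y v) = poisson z y * pker w v.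
Proof.
rewrite /poisson (bigD1_ord ord_max)//= !snoc_last mulrC; congr (_ * _).
by apply: eq_bigr => j _; rewrite !snoc_lift.
Qed.

End snoc.

(** * The Herglotz transform of a rational inner function *)

Section rif.
Context {R : realType} (d : nat).
Local Notation C := R[i].
Variables (n : mpoly.multinom d.+1) (p : mpoly.mpoly d.+1 C).
Hypothesis pn : forall j, degree_in p j = n j.
Hypothesis p0 : no_singularities p.
Hypothesis n0 : (0 < n ord_max)%N.
Variable alpha : C.
Hypothesis alpha1 : `|alpha| = 1.

Local Notation phi := (rational_function n p).
Local Notation last := (@ord_max d).

Definition herglotz_re (z : 'rV[C]_d.+1) : R :=
  (1 - Normc.normc (phi z) ^+ 2) / Normc.normc (alpha - phi z) ^+ 2.

Lemma phi_slice i z w : phi (upd z i w) = (rslice n p i z).[w] / (pslice p i z).[w].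
Proof. by rewrite psliceE rsliceE. Qed.

Lemma continuous_phi z : closed_polydisc z -> {for z, continuous phi}.
Proof.
move=> zd; have FF := @nbhs_filter 'rV[C]_d.+1 z; have pz := p0 zd.
have h := @cvgV C _ (nbhs z) FF _ _ pz (@continuous_peval R _ p z).
exact: (@cvgM C _ (nbhs z) FF _ _ _ _ (@continuous_reflect R _ n p z) h).
Qed.

Lemma phi_lt1_torus (z : 'rV[C]_d) w : torus z -> `|w| < 1 ->
  Normc.normc (phi (snoc z w)) < 1.
Proof.
(* The slice in the last variable ignores the last coordinate; 1 is an arbitrary unimodular
   choice. *)
move=> zt w1; have zt1 : torus (snoc z (1 : C)) by apply: torus_snoc => //; exact: normr1.
have [c [c' [bs [[sbs b1 c0 cc'] [pE qE]]]]] := slice_blaschke pn p0 last zt1.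
rewrite -(upd_snoc_last z 1 w) phi_slice normc_lt1 pE qE !hornerZ.
have lt := norm_bpoly_lt b1 _ w1.
have lt' := lt (eq_ind_r (fun k => 0 < k)%N n0 sbs).
rewrite normrM normfV !normrM cc' ltr_pdivrMr; last first.
  by rewrite mulr_gt0 ?normr_gt0// -normr_gt0 (le_lt_trans _ lt').
by rewrite mul1r ltr_pM2l ?normr_gt0.
Qed.

Lemma phi_separately w : `|w| <= 1 ->
  separately_disc_algebra (fun z : 'rV[C]_d => phi (snoc z w)).
Proof.
move=> w1 z i zd.
have zwd : closed_polydisc (snoc z w) by exact: closed_polydisc_snoc.
apply: disc_algebra_ext (@disc_algebra_frac R (rslice n p (lift last i) (snoc z w))
  (pslice p (lift last i) (snoc z w)) _).
  by move=> v _; rewrite snoc_upd phi_slice.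
by move=> v v1; exact: pslice_neq0.
Qed.

Lemma continuous_phi_snoc w (z : 'rV[C]_d) : `|w| <= 1 -> closed_polydisc z ->
  {for z, continuous (fun z : 'rV[C]_d => phi (snoc z w))}.
Proof.
move=> w1 zd; apply: (@continuous_comp _ _ _ (fun z : 'rV[C]_d => snoc z w) phi).
  exact: continuous_snoc.
by apply: continuous_phi; exact: closed_polydisc_snoc.
Qed.

(** For fixed [w] the strict bound on the torus is uniform by compactness, [h] being bounded there
    by some [M]. The maximum principle then carries [1 - M^-1] to the closed polydisc; a bound by 1
    alone would not exclude poles of the Herglotz transform. *)
Lemma phi_lt1 (z : 'rV[C]_d) w : closed_polydisc z -> `|w| < 1 ->
  Normc.normc (phi (snoc z w)) < 1.
Proof.
move=> zd w1; pose h (y : 'rV[C]_d) := (1 - Normc.normc (phi (snoc y w)))^-1.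
have ch : {within torus, continuous h}.
  apply: within_torus_continuous => y yt; have FF := @nbhs_filter 'rV[C]_d y.
  have cphi : {for y, continuous (fun y => Normc.normc (phi (snoc y w)))}.
    apply: (@continuous_comp _ _ _ (fun y : 'rV[C]_d => phi (snoc y w))).
      by apply: continuous_phi_snoc; [exact: ltW|exact: torus_closed_polydisc].
    exact: continuous_normc.
  have n1 : 1 - Normc.normc (phi (snoc y w)) != 0.
    by rewrite gt_eqF// subr_gt0 phi_lt1_torus.
  apply: (@cvgV R _ (nbhs y) FF _ _ n1).
  apply: (@cvgB R _ _ (nbhs y) FF); last exact: cphi.
  exact: (@cvg_cst _ _ _ _ FF).
have [M M0 hM] := bounded_within_torus ch.
apply: (@le_lt_trans _ _ (1 - M^-1)); last by rewrite ltrBlDr ltrDl invr_gt0.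
apply: (polydisc_max (phi_separately (ltW w1))) => // y yt.
have := hM y yt; rewrite /h.
have y1 : 0 < 1 - Normc.normc (phi (snoc y w)) by rewrite subr_gt0 phi_lt1_torus.
rewrite ger0_norm ?invr_ge0 ?(ltW y1)// => hy.
by rewrite lerBrDr -lerBrDl -[leRHS]invrK lef_pV2 ?posrE ?invr_gt0.
Qed.

Lemma alpha_phi_neq0 (z : 'rV[C]_d) w : closed_polydisc z -> `|w| < 1 ->
  alpha - phi (snoc z w) != 0.
Proof.
move=> zd w1; rewrite subr_eq0; apply: contraTneq (phi_lt1 zd w1) => <-.
by rewrite (normc_eq1 alpha1) ltxx.
Qed.

(** By [alpha_phi_neq0], the denominators [alpha P - Q] of the slices have no zero on the closed
    disc, so the Poisson formula applies to the Herglotz transform. *)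
Lemma poisson_herglotz_re (z : 'rV[C]_d) w : polydisc z -> `|w| < 1 ->
  \int[torus_measure d]_(y in torus) (poisson z y * herglotz_re (snoc y w)) =
  herglotz_re (snoc z w).
Proof.
move=> zd w1.
pose H (y : 'rV[C]_d) := (alpha + phi (snoc y w)) / (alpha - phi (snoc y w)).
have HE (y : 'rV[C]_d) : herglotz_re (snoc y w) = complex.Re (H y) by rewrite Re_cayley.
rewrite HE -(poisson_torus zd).
- by apply: eq_Rintegral => y _; rewrite HE.
- move=> y i yd; set l := lift last i.
  have ywd : closed_polydisc (snoc y w) by apply: closed_polydisc_snoc => //; exact: ltW.
  pose P := pslice p l (snoc y w); pose Q := rslice n p l (snoc y w).
  have P0 (v : C) : `|v| <= 1 -> P.[v] != 0 by move=> v1; exact: pslice_neq0.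
  apply: disc_algebra_ext (@disc_algebra_frac R (alpha *: P + Q) (alpha *: P - Q) _).
    move=> v v1; rewrite /H snoc_upd phi_slice -/P -/Q !hornerE.
    have -> : alpha + Q.[v] / P.[v] = (alpha * P.[v] + Q.[v]) / P.[v].
      by field; exact: P0.
    have -> : alpha - Q.[v] / P.[v] = (alpha * P.[v] - Q.[v]) / P.[v].
      by field; exact: P0.
    by rewrite -mulf_div divff ?mulr1// invr_eq0 P0.
  move=> v v1; have := alpha_phi_neq0 (closed_polydisc_upd i yd v1) w1.
  rewrite snoc_upd phi_slice -/P -/Q !hornerE; apply: contra => /eqP e.
  by rewrite -(mulfK (P0 v v1) alpha) -mulrBl e mul0r.
- move=> y yd; have FF := @nbhs_filter 'rV[C]_d y.
  have cp : {for y, continuous (fun y => phi (snoc y w))}.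
    by apply: continuous_phi_snoc => //; exact: ltW.
  have ca := @cvg_cst C alpha _ (nbhs y) FF.
  have h1 := @cvgB C C _ (nbhs y) FF _ _ _ _ ca cp.
  have h2 := @cvgD C C _ (nbhs y) FF _ _ _ _ ca cp.
  have h3 := @cvgV C _ (nbhs y) FF _ _ (alpha_phi_neq0 yd w1) h1.
  exact: (@cvgM C _ (nbhs y) FF _ _ _ _ h2 h3).
Qed.

Lemma mslice_upd (I : eqType) (s : seq I) (a : I -> C) (e : I -> 'I_d.+1 -> nat) i z v :
  mslice s a e i (upd z i v) = mslice s a e i z.
Proof.
apply: eq_bigr => m _; congr (_ * _ *: _).
by apply: eq_bigr => j ji; rewrite mxE (negbTE ji).
Qed.

(** The slice is a unimodular constant times a Blaschke product [B] with [w B' = B * bderiv] on the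
    circle, and [|B| = 1] there. *)
Lemma normc_partial_last (z : 'rV[C]_d.+1) c c' bs : torus z ->
  all (fun b => `|b| < 1) bs -> c != 0 -> `|c'| = `|c| ->
  pslice p last z = c *: bpoly_den bs -> rslice n p last z = c' *: bpoly_num bs ->
  Normc.normc (partial_last phi z) = bderiv bs (z 0 last).
Proof.
move=> zt b1 c0 cc' pE qE; set g := z 0 last; have g1 : `|g| = 1 by exact: zt.
have pz := p0 (torus_closed_polydisc zt).
rewrite /partial_last rif_derivE// /rif_deriv.
have pzE : peval p z = (pslice p last z).[g] by rewrite psliceE upd_id.
have qzE : peval (Defs.reflect n p) z = (rslice n p last z).[g] by rewrite rsliceE upd_id.
rewrite -/g pzE qzE pE qE !derivZ !hornerZ.
set A := (bpoly_den bs).[g]; set B := (bpoly_num bs).[g].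
set A' := (bpoly_den bs)^`().[g]; set B' := (bpoly_num bs)^`().[g].
have A0 : A != 0 by apply: bpoly_den_neq0; rewrite ?g1.
have g0 := unit_neq0 g1.
have h : g * (B' * A - B * A') = B * A * (bderiv bs g)%:C%C := bpoly_deriv b1 g1.
have -> : (c' * B' * (c * A) - c' * B * (c * A')) / (c * A) ^+ 2 =
    (c' / c) * (B / A) * (bderiv bs g)%:C%C / g.
  apply: (mulfI g0).
  have -> : g * ((c' * B' * (c * A) - c' * B * (c * A')) / (c * A) ^+ 2) =
      (g * (B' * A - B * A')) * (c' * c) / (c * A) ^+ 2 by ring.
  by rewrite h; field; rewrite g0 A0 c0.
apply: (@complexI R); rewrite -normC_normc !normrM !normfV cc' g1 invr1 mulr1.
rewrite (norm_bpoly bs g1) !divff ?normr_eq0// !mul1r.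
rewrite normC_real ger0_norm// /bderiv big_seq; apply: sumr_ge0 => b bbs.
by rewrite pker_ge0// normcJ (allP b1).
Qed.

Lemma normc_partial_last_gt0 (z : 'rV[C]_d.+1) : torus z ->
  0 < Normc.normc (partial_last phi z).
Proof.
move=> zt.
have [c [c' [bs [[sbs b1 c0 cc'] [pE qE]]]]] := slice_blaschke pn p0 last zt.
by rewrite (normc_partial_last zt b1 c0 cc' pE qE) bderiv_gt0 ?sbs.
Qed.

Lemma clark_slice (z : 'rV[C]_d) (g : 'I_(n last) -> C) w : torus z ->
  (forall j, `|g j| = 1) -> injective g -> (forall j, phi (snoc z (g j)) = alpha) ->
  `|w| < 1 ->
  herglotz_re (snoc z w) =
  \sum_j pker w (g j) / Normc.normc (partial_last phi (snoc z (g j))).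
Proof.
move=> zt g1 gI ga w1; pose z1 := snoc z (1 : C).
have zt1 : torus z1 by apply: torus_snoc => //; exact: normr1.
have [c [c' [bs [[sbs b1 c0 cc'] [pE qE]]]]] := slice_blaschke pn p0 last zt1.
have sE v : snoc z v = upd z1 last v by rewrite upd_snoc_last.
have pg j : (pslice p last z1).[g j] != 0.
  by apply: pslice_neq0; rewrite ?g1//; exact: torus_closed_polydisc.
rewrite /herglotz_re sE phi_slice.
rewrite (clark_blaschke n0 sbs b1 c0 cc' pE qE alpha1 g1 gI _ w1); last first.
  by move=> j; rewrite -(ga j) sE phi_slice divfK.
apply: eq_bigr => j _; congr (_ / _).
have zgt : torus (snoc z (g j)) by exact: torus_snoc.
rewrite (@normc_partial_last _ c c' bs zgt)// ?snoc_last//.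
  by rewrite sE /pslice mslice_upd.
by rewrite sE /rslice mslice_upd.
Qed.

End rif.

(** * Points of the level set *)

Section level_set.
Context {R : realType} (d : nat).
Local Notation C := R[i].
Variables (n : mpoly.multinom d.+1) (p : mpoly.mpoly d.+1 C).
Hypothesis p0 : no_singularities p.

Local Notation phi := (rational_function n p).

Lemma continuous_real_complex : continuous (fun x : R => x%:C%C : C).
Proof.
move=> x; apply/cvgrPdist_lt => e e0.
have eE : e = (complex.Re e)%:C%C by rewrite RRe_real// gtr0_real.
have e0' : 0 < complex.Re e by rewrite -(ltcR 0) -eE.
near=> y; rewrite -rmorphB normC_real eE ltcR.
by near: y; have /cvgrPdist_lt := @cvg_id _ (nbhs x); exact.
Unshelve. all: by end_near. Qed.

Lemma radial_cvg (z : 'rV[C]_d.+1) :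
  (fun r : R => r%:C%C *: z) @ 1^'- --> z.
Proof.
have F1 := @nbhs_filter R (1 : R).
have c1 : (fun r : R => r%:C%C *: z) @ nbhs (1 : R) --> z.
  apply: (cvg_row F1) => j.
  have cj := @cvg_cst C (z 0 j) _ (nbhs (1 : R)) F1.
  have h := @cvgM C _ (nbhs (1 : R)) F1 _ _ _ _ (@continuous_real_complex 1) cj.
  rewrite (_ : (fun x : R => _) = (fun x : R => x%:C%C * z 0 j)); last first.
    by apply/funext => x; rewrite !mxE.
  by rewrite -[z 0 j in X in _ --> X]mul1r -[1 in X in _ --> X](rmorph1 (real_complex R)).
exact: (@cvg_within_filter _ _ _ (nbhs (1 : R)) F1 (nbhs z) _ c1).
Qed.

(** By continuity of [phi] up to the torus, radial limits are values, and the closure stays in the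
    closed set where [phi = alpha]. *)
Lemma level_set_sub (alpha : C) : level_set phi alpha `<=` [set z | torus z /\ phi z = alpha].
Proof.
have cS : closed [set z : 'rV[C]_d.+1 | torus z /\ phi z = alpha].
  move=> z cz; have zt : torus z.
    by apply: closed_torus => B /cz [y [[yt _] yB]]; exists y.
  split => //; apply: contrapT => /eqP pza.
  have FF := @nbhs_filter 'rV[C]_d.+1 z.
  have cp : {for z, continuous phi}.
    by apply: continuous_phi => //; exact: torus_closed_polydisc.
  have h := @cvgB C C _ (nbhs z) FF _ _ _ _ cp (@cvg_cst C alpha _ (nbhs z) FF).
  have pza0 : phi z - alpha != 0 by rewrite subr_eq0.
  have := cz _ (@cvgr_neq0 C C _ (nbhs z) FF _ _ h pza0).
  move=> [y [[_ ya] yn]]; have : phi y - alpha != 0 by exact: yn.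
  by rewrite ya subrr eqxx.
rewrite (proj1 (closure_id _) cS); apply: closureS => z [zt za]; split => //.
have cp : {for z, continuous phi}.
  by apply: continuous_phi => //; exact: torus_closed_polydisc.
have h : (fun r : R => phi (r%:C%C *: z)) @ 1^'- --> phi z by exact: (cvg_comp _ _ (@radial_cvg z) cp).
exact: (@cvg_unique _ (@norm_hausdorff _ C) _ _ _ _ h za).
Qed.

End level_set.

(** * Integration along the level set *)

Section weighted_integral.
Context {R : realType} {n : nat} {disp : measure_display} {T : measurableType disp}.
Local Notation C := R[i].
Variables (mu : {measure set T -> \bar R}) (D : set T).
Hypotheses (mD : measurable D) (muD : (mu D < +oo)%E).
Variables (phi : T -> 'rV[C]_n) (w : T -> R) (M : R).
Hypotheses (mphi : measurable_fun D (phi : T -> borel 'rV[C]_n))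
  (phit : forall x, D x -> torus (phi x))
  (mw : measurable_fun D w) (wM : forall x, D x -> `|w x| <= M).
Implicit Types h : 'rV[C]_n -> R.

(** Both sides of the formula have this shape: a graph with the inverse derivative as weight, or the
    identity map with weight 1 for the Clark measure. *)
Lemma wint_integrable h : {within torus, continuous h} ->
  mu.-integrable D (EFin \o (fun x => h (phi x) * w x)).
Proof.
move=> ch; have [K K0 hK] := bounded_within_torus ch.
apply: (bounded_integrable mD muD (M := K * M)).
  by apply: measurable_funM => //; exact: measurable_within_torus.
by move=> x Dx; rewrite normrM ler_pM ?hK ?wM//; exact: phit.
Qed.

Lemma wint_sum (I : finType) (c : I -> R) (h : I -> 'rV[C]_n -> R) :
  (forall k, {within torus, continuous (h k)}) ->
  \int[mu]_(x in D) ((\sum_k c k * h k (phi x)) * w x) =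
  \sum_k c k * \int[mu]_(x in D) (h k (phi x) * w x).
Proof.
move=> ch.
have ih k : mu.-integrable D (EFin \o (fun x => c k * (h k (phi x) * w x))).
  have := integrableZl mD (c k) (wint_integrable (ch k)).
  by congr (_.-integrable _ _).
under eq_Rintegral do rewrite mulr_suml.
transitivity (\int[mu]_(x in D) (\sum_k c k * (h k (phi x) * w x))).
  by apply: eq_Rintegral => x _; apply: eq_bigr => k _; rewrite mulrA.
rewrite Rintegral_sum//; apply: eq_bigr => k _.
by rewrite RintegralZl//; exact: wint_integrable.
Qed.

Lemma wint_dist h1 h2 (e : R) : {within torus, continuous h1} -> {within torus, continuous h2} ->
  (forall y, torus y -> `|h1 y - h2 y| <= e) ->
  `|\int[mu]_(x in D) (h1 (phi x) * w x) - \int[mu]_(x in D) (h2 (phi x) * w x)| <=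
    e * M * fine (mu D).
Proof.
move=> c1 c2 he; apply: Rintegral_le_dist => //; [exact: wint_integrable..|].
by move=> x Dx; rewrite -mulrBl normrM ler_pM ?he ?wM//; exact: phit.
Qed.

End weighted_integral.

(** * Functionals determined by the Poisson kernels *)

Section poisson_determined.
Context {R : realType} (n : nat).
Local Notation C := R[i].

(** Functionals accept arbitrary functions, on which integration need not be additive; linearity is
    asked only where it is used. *)
Definition poisson_linear (L : ('rV[C]_n -> R) -> R) :=
  forall (I : finType) (c : I -> R) (z : I -> 'rV[C]_n), (forall k, polydisc (z k)) ->
    L (fun y => \sum_k c k * poisson (z k) y) = \sum_k c k * L (poisson (z k)).

(** Stated for differences, as [L] is not assumed linear on all continuous functions. *)
Definition torus_bounded (L : ('rV[C]_n -> R) -> R) :=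
  exists K : R, forall (h1 h2 : 'rV[C]_n -> R) e,
    {within torus, continuous h1} -> {within torus, continuous h2} ->
    (forall y, torus y -> `|h1 y - h2 y| <= e) -> `|L h1 - L h2| <= K * e.

Lemma poisson_determined (L1 L2 : ('rV[C]_n -> R) -> R) :
  poisson_linear L1 -> torus_bounded L1 -> poisson_linear L2 -> torus_bounded L2 ->
  (forall z, polydisc z -> L1 (poisson z) = L2 (poisson z)) ->
  forall h, {within torus, continuous h} -> L1 h = L2 h.
Proof.
move=> l1 [K1 b1] l2 [K2 b2] L12 h ch; apply: (@eq_eps _ _ _ (K1 + K2)) => e e0.
have [I [c [z [zd hz]]]] := poisson_dense ch e0.
pose k (y : 'rV[C]_n) := \sum_k c k * poisson (z k) y.
have ck : {within torus, continuous k}.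
  apply: within_torus_continuous => y yt; have FF := @nbhs_filter 'rV[C]_n y.
  apply: (@cvg_sum_seq R R _ (nbhs y) FF) => i.
  apply: (@cvgM _ _ (nbhs y) FF); first exact: (@cvg_cst _ _ _ _ FF).
  exact: continuous_poisson.
have Lk : L1 k = L2 k.
  by rewrite l1// l2//; apply: eq_bigr => i _; rewrite L12.
rewrite (_ : L1 h - L2 h = (L1 h - L1 k) - (L2 h - L2 k)); last by rewrite Lk; ring.
by rewrite (le_trans (ler_normB _ _))// mulrDl lerD// ?b1 ?b2.
Qed.

End poisson_determined.

(** * The formula for real-valued functions *)

Section clark_formula.
Context {R : realType} (d : nat).
Local Notation C := R[i].
Variables (n : mpoly.multinom d.+1) (p : mpoly.mpoly d.+1 C).
Hypothesis pn : forall j, degree_in p j = n j.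
Hypothesis p0 : no_singularities p.
Hypothesis n0 : (0 < n ord_max)%N.
Variable alpha : C.
Hypothesis alpha1 : `|alpha| = 1.
Local Notation phi := (rational_function n p).
Variable g : 'I_(n ord_max) -> 'rV[C]_d -> C.
Hypothesis hg : parametrizes g (level_set phi alpha).

Local Notation graph j z := (snoc z (g j z)).
Local Notation weight y := (Normc.normc (partial_last phi y))^-1.

Lemma torus_graph j z : torus z -> torus (graph j z).
Proof. by move=> zt; apply: torus_snoc => //; exact: (param_torus hg). Qed.

Lemma phi_graph j z : torus z -> phi (graph j z) = alpha.
Proof.
move=> zt; have : level_set phi alpha (graph j z).
  by rewrite (param_graphs hg); exists z, j.
by move=> /(level_set_sub p0)[].
Qed.

Lemma measurable_graph j :
  measurable_fun (torus : set (borel 'rV[C]_d)) (fun z => graph j z : borel 'rV[C]_d.+1).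
Proof.
apply: measurable_row => k; case: (unliftP ord_max k) => [l|] ->.
  rewrite (_ : (fun z : 'rV[C]_d => _) = (fun z => z 0 l)); last first.
    by apply/funext => z; rewrite snoc_lift.
  move=> mt; apply: (@measurability _ _ _ (borel C) _ _ (@open C)) => // _ [V oV <-].
  apply: measurableI => //; apply: sub_sigma_algebra.
  by apply: open_comp => // z _; exact: coord_continuous.
rewrite (_ : (fun z : 'rV[C]_d => _) = g j); first exact: (param_measurable hg).
by apply/funext => z; rewrite snoc_last.
Qed.

(** Continuity comes from [rif_deriv], which equals the derivative on the torus, and nonvanishing
    from the positivity of [bderiv]. *)
Lemma continuous_weight : {within torus, continuous (fun y => weight y)}.
Proof.
apply: (@subspace_eq_continuous _ _ _ (fun y => (Normc.normc (rif_deriv n p ord_max y))^-1)).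
  move=> y /set_mem yt; congr (Normc.normc _)^-1.
  by rewrite -rif_derivE//; apply: p0; exact: torus_closed_polydisc.
apply: within_torus_continuous => y yt; have FF := @nbhs_filter 'rV[C]_d.+1 y.
have py : peval p y != 0 by apply: p0; exact: torus_closed_polydisc.
have y0 : Normc.normc (rif_deriv n p ord_max y) != 0.
  by rewrite -rif_derivE// gt_eqF//; exact: normc_partial_last_gt0.
apply: (@cvgV R _ (nbhs y) FF _ _ y0).
apply: (@continuous_comp _ _ _ (rif_deriv n p ord_max)).
  exact: continuous_rif_deriv.
exact: continuous_normc.
Qed.

Definition graph_functional (h : 'rV[C]_d.+1 -> R) : R :=
  \sum_j \int[torus_measure d]_(z in torus) (h (graph j z) * weight (graph j z)).

Let mt := @measurable_torus R d.

Let fin_torus : (torus_measure d (torus : set (borel 'rV[C]_d)) < +oo)%E.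
Proof. by rewrite (le_lt_trans (probability_le1 _ mt))// ltry. Qed.

Let measurable_weight j : measurable_fun (torus : set (borel 'rV[C]_d)) (fun z => weight (graph j z)).
Proof.
apply: (measurable_within_torus continuous_weight (measurable_graph j)).
exact: torus_graph.
Qed.

Lemma graph_functional_linear : poisson_linear graph_functional.
Proof.
move=> I c z zd; rewrite /graph_functional.
have [M M0 wM] := bounded_within_torus continuous_weight.
have key j : \int[torus_measure d]_(y in torus)
    ((\sum_k c k * poisson (z k) (graph j y)) * weight (graph j y)) =
    \sum_k c k * \int[torus_measure d]_(y in torus)
      (poisson (z k) (graph j y) * weight (graph j y)).
  have wj x : torus x -> `|weight (graph j x)| <= M by move=> xt; exact/wM/torus_graph.
  exact: (wint_sum mt fin_torus (measurable_graph j) (@torus_graph j)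
    (measurable_weight j) wj c (fun k => within_continuous_poisson (zd k))).
rewrite (eq_bigr _ (fun j _ => key j)).
by rewrite exchange_big/=; apply: eq_bigr => k _; rewrite mulr_sumr.
Qed.

Lemma graph_functional_bounded : torus_bounded graph_functional.
Proof.
have [M M0 wM] := bounded_within_torus continuous_weight.
exists (\sum_(j < n ord_max) M * fine (torus_measure d (torus : set (borel 'rV[C]_d)))) => h1 h2 e c1 c2 he.
rewrite /graph_functional -sumrB mulr_suml (le_trans (ler_norm_sum _ _ _))//.
apply: ler_sum => j _.
rewrite [leRHS](_ : _ = e * M * fine (torus_measure d (torus : set (borel 'rV[C]_d)))); last by ring.
have wj x : torus x -> `|weight (graph j x)| <= M by move=> xt; exact/wM/torus_graph.
exact: (wint_dist mt fin_torus (measurable_graph j) (@torus_graph j) (measurable_weight j)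
  wj c1 c2 he).
Qed.

(** The kernel factors into its z' part and its last-variable part. Summed over [j] under the
    integral, the latter gives the real part of the Herglotz transform at [(y, w)], which the
    Poisson formula in z' evaluates. *)
Lemma graph_functional_poisson z : polydisc z ->
  graph_functional (poisson z) = herglotz_re n p alpha z.
Proof.
move=> zd; rewrite (snoc_eta z); set z' := \row_j _; set w := z 0 ord_max.
have w1 : `|w| < 1 by exact: zd.
have zd' : polydisc z' by move=> j; rewrite mxE.
rewrite -poisson_herglotz_re// /graph_functional.
have [M M0 wM] := bounded_within_torus continuous_weight.
rewrite -(Rintegral_sum mt) => [|j]; last first.
  have wj x : torus x -> `|weight (graph j x)| <= M by move=> xt; exact/wM/torus_graph.
  exact: (wint_integrable mt fin_torus (measurable_graph j) (@torus_graph j)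
    (measurable_weight j) wj (within_continuous_poisson (polydisc_snoc zd' w1))).
apply: eq_Rintegral => y /set_mem yt.
rewrite (clark_slice pn p0 n0 alpha1 yt (g := g ^~ y))//.
- by rewrite mulr_sumr; apply: eq_bigr => j _; rewrite poisson_snoc mulrA.
- by move=> j; exact: (param_torus hg).
- exact: (param_inj hg).
- by move=> j; exact: phi_graph.
Qed.

Variable sigma : {measure set (borel 'rV[C]_d.+1) -> \bar R}.
Hypothesis hsigma : Clark_measure phi alpha sigma.

Let mt1 := @measurable_torus R d.+1.

Lemma poisson0 m (y : 'rV[C]_m) : torus y -> poisson 0 y = 1.
Proof.
move=> yt; apply: big1 => j _.
by rewrite mxE subr0 Normc.normc0 (normc_eq1 (yt j)) expr0n/= subr0 expr1n invr1 mulr1.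
Qed.

(** At [z = 0] the Poisson kernel is 1, so the defining identity equates the mass with a real
    number. *)
Lemma Clark_finite : (sigma torus < +oo)%E.
Proof.
have [_ /(_ 0)] := hsigma.
have z0 : polydisc (0 : 'rV[C]_d.+1) by move=> j; rewrite mxE normr0.
move=> /(_ z0); rewrite (eq_integral (cst 1%E)).
  by rewrite integral_cst// mul1e => <-; rewrite ltry.
by move=> y /set_mem yt; rewrite /= poisson0.
Qed.

(** The factor 1 gives this integral the weighted form of the graph side. *)
Let clark_functional (h : 'rV[C]_d.+1 -> R) : R := \int[sigma]_(y in torus) (h y * 1).

Lemma clark_formula (h : 'rV[C]_d.+1 -> R) : {within torus, continuous h} ->
  \int[sigma]_(y in torus) h y =
  \sum_j \int[torus_measure d]_(z in torus) (h (graph j z) * weight (graph j z)).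
Proof.
move=> ch; transitivity (clark_functional h).
  by apply: eq_Rintegral => y _; rewrite mulr1.
have mid : measurable_fun (torus : set (borel 'rV[C]_d.+1)) (id : _ -> borel 'rV[C]_d.+1).
  exact: measurable_id.
have m1 : measurable_fun (torus : set (borel 'rV[C]_d.+1)) (fun=> 1 : R) by [].
have tid (y : 'rV[C]_d.+1) : torus y -> torus (id y) by [].
have w1 (y : 'rV[C]_d.+1) : torus y -> `|1 : R| <= 1 by rewrite normr1.
apply: (@poisson_determined _ _ clark_functional graph_functional) => //.
- move=> I c z zd.
  exact: (wint_sum mt1 Clark_finite mid tid m1 w1 c
    (fun k => within_continuous_poisson (zd k))).
- exists (fine (sigma torus)) => h1 h2 e c1 c2 he.
  by have := wint_dist mt1 Clark_finite mid tid m1 w1 c1 c2 he; rewrite mulr1 mulrC.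
- exact: graph_functional_linear.
- exact: graph_functional_bounded.
- move=> z zd; rewrite graph_functional_poisson// /clark_functional.
  have [_ /(_ z zd) sz] := hsigma.
  rewrite /Rintegral /herglotz_re -[RHS]/(fine (_%:E)) sz; congr fine.
  by apply: eq_integral => y _; rewrite mulr1.
Qed.

End clark_formula.

Section complex_parts.
Context {R : realType}.
Local Notation C := R[i].

Lemma Im_sum I (s : seq I) (F : I -> C) :
  complex.Im (\sum_(i <- s) F i) = \sum_(i <- s) complex.Im (F i).
Proof. by elim/big_rec2: _ => //= i y z _ <-; case: (F i) z => ? ? []. Qed.

Lemma Re_div_norm (z w : C) : complex.Re (z / `|w|) = complex.Re z * (Normc.normc w)^-1.
Proof. by rewrite normC_normc -fmorphV mulrC Re_realM mulrC. Qed.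

Lemma Im_div_norm (z w : C) : complex.Im (z / `|w|) = complex.Im z * (Normc.normc w)^-1.
Proof. by rewrite normC_normc -fmorphV; case: z => a b /=; rewrite mulr0 add0r. Qed.

Lemma within_continuous_parts (T : topologicalType) (A : set T) (f : T -> C) :
  {within A, continuous f} ->
  {within A, continuous (fun x => complex.Re (f x))} /\
  {within A, continuous (fun x => complex.Im (f x))}.
Proof.
move=> cf; split => x.
  by apply: (@continuous_comp _ _ _ (f : subspace A -> C)); [exact: cf|exact: continuous_Re].
by apply: (@continuous_comp _ _ _ (f : subspace A -> C)); [exact: cf|exact: continuous_Im].
Qed.

End complex_parts.

(* The dimension of the polydisc is d.+1. *)
Theorem theorem3p5 (R : realType) (d : nat) (hd : (2 <= d.+1)%N)
    (n : mpoly.multinom d.+1) (p : mpoly.mpoly d.+1 R[i])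
    (hp : polydegree_RIF n p) (hsing : no_singularities p)
    (alpha : R[i]) (halpha : `|alpha| = 1)
    (sigma : {measure set (borel 'rV[R[i]]_d.+1) -> \bar R})
    (hsigma : Clark_measure (rational_function n p) alpha sigma)
    (g : 'I_(n ord_max) -> 'rV[R[i]]_d -> R[i])
    (hg : parametrizes g (level_set (rational_function n p) alpha))
    (f : 'rV[R[i]]_d.+1 -> R[i]) (hf : {within torus, continuous f}) :
  Cintegral sigma torus f =
  \sum_(j < n ord_max) Cintegral (torus_measure d) torus (fun z' =>
    f (snoc z' (g j z')) /
      `|partial_last (rational_function n p) (snoc z' (g j z'))|).
Proof.
have pn := RIF_degree hp; have n0 := RIF_polydegree_gt0 hp ord_max.
have [cRe cIm] := within_continuous_parts hf.
have formula := clark_formula pn hsing n0 halpha hg hsigma.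
(* The weights are real, so the real formula applies to the real and imaginary parts of [f]
   separately. *)
apply/eqP; rewrite eq_complex Re_sum Im_sum /Cintegral /= !formula//.
apply/andP; split; apply/eqP; apply: eq_bigr => j _; apply: eq_Rintegral => z _.
  by rewrite Re_div_norm.
by rewrite Im_div_norm.
Qed.
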